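(* Let $n$ be even. The class $[qA]_b\in\mathrm{H}_b^n(\mathrm{GL}_n(\mathbb{R}),\mathbb{R}_\varepsilon)$ defined by the cocycle $A$ has canonical semi-norm $\|[qA]_b\|=1$.
   Context: $\mathbb{R}_\varepsilon$ is $\mathbb{R}$ with $g\in\mathrm{GL}_n(\mathbb{R})$ acting by $\operatorname{sign}\det g$. $\mathcal{F}(\mathbb{R}^n)$ is the space of complete flags with its $\mathrm{GL}_n(\mathbb{R})$-quasi-invariant measure class; $\mathrm{H}_b^\bullet(\mathrm{GL}_n(\mathbb{R}),\mathbb{R}_\varepsilon)$ (continuous bounded cohomology with its canonical semi-norm) is isometrically computed by the complex of $\mathrm{GL}_n(\mathbb{R})$-equivariant elements of $L^\infty(\mathcal{F}(\mathbb{R}^n)^{\bullet+1},\mathbb{R}_\varepsilon)$, and $[qA]_b$ is the class of the a.e.-class $qA$ of $A$. Definition of $A$: a complete oriented flag is a complete flag with a chosen open half-space $(F^i)^+$ of $F^i$ bounded by $F^{i-1}$ for each $i$ (inducing compatible orientations: $(v_1,\dots,v_{i-1},x)$ positive in $F^i$ iff $(v_1,\dots,v_{i-1})$ positive in $F^{i-1}$ and $x\in(F^i)^+$). For an oriented $k$-dimensional subspace $W$ ($0\le k\le n-1$) and oriented flag $F$, with $d$ the unique $1\le d\le k+1$ such that $F^{d-1}\subseteq W$, $F^d\not\subseteq W$, $[W,F]$ is $W+F^d$ oriented by a positive basis of $W$ followed by $x\in(F^d)^+$; $[F_1]=F_1^1$, $[F_1,\dots,F_k]=[[F_1,\dots,F_{k-1}],F_k]$.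 $\mathrm{Or}(U)\in\{\pm1\}$ is the sign of an orientation $U$ of $\mathbb{R}^n$ relative to the canonical one. $E(F_0,\dots,F_n)=\prod_{i=0}^n\mathrm{Or}([F_0,\dots,\widehat{F_i},\dots,F_n])$ for oriented flags, and $A(F_0,\dots,F_n)=2^{-n(n+1)}\sum E(F_0',\dots,F_n')$ over all oriented lifts $F_i'$ of the flags $F_i$. $A$ is a $\mathrm{GL}_n(\mathbb{R})$-equivariant everywhere-defined Borel cocycle. *)

(* Defs.v *)
From HB Require Import structures.
From mathcomp Require Import all_boot all_order all_algebra.
From mathcomp Require Import all_classical all_reals.
From mathcomp Require Import measure.
Set Implicit Arguments. Unset Strict Implicit. Unset Printing Implicit Defensive.
Import Order.TTheory GRing.Theory Num.Theory.
Local Open Scope classical_set_scope.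
Local Open Scope ring_scope.

Section BoundedCohomologyGLn.
Variables (R : realType) (n : nat).

(* Encoding of complete (oriented) flags of R^n by invertible matrices *)
(* A matrix M in GL_n(R) represents the complete flag F^i = span of    *)
(* its first i columns; as an oriented flag, F^i is oriented by the    *)
(* first i columns and (F^i)^+ is the half-space containing column i.  *)
(* Two invertible matrices represent the same flag iff they differ by  *)
(* right multiplication by an invertible upper triangular matrix.      *)

Definition upper_inv (b : 'M[R]_n) : Prop :=
  (forall i j : 'I_n, (j < i)%N -> b i j = 0) /\ b \in unitmx.

Definition pts (m : nat) := 'I_m -> 'M[R]_n.

Definition GLt (m : nat) (x : pts m) : Prop := forall i, x i \in unitmx.

Definition box (I : finType) (lo hi : I -> R) : set (I -> R) :=
  [set p | forall i, lo i <= p i <= hi i].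

Definition boxvol (I : finType) (lo hi : I -> R) : R :=
  \prod_(i : I) Num.max 0 (hi i - lo i).

Definition lnull (I : finType) (S : set (I -> R)) : Prop :=
  forall e : R, 0 < e -> exists lo hi : nat -> I -> R,
    S `<=` \bigcup_j box (lo j) (hi j) /\
    forall N, \sum_(j < N) boxvol (lo j) (hi j) <= e.

Definition borel (I : finType) : set (set (I -> R)) :=
  <<s [set B | exists lo hi : I -> R, B = box lo hi] >>.

Definition uncoords (m : nat) (p : 'I_m * 'I_n * 'I_n -> R) : pts m :=
  fun i => \matrix_(a, b) p (i, a, b).

Definition tnull (m : nat) (S : set (pts m)) : Prop :=
  lnull [set p | S (uncoords p)].

Definition tborel (m : nat) (S : set (pts m)) : Prop :=
  borel [set p | S (uncoords p)].

Definition flag_fun (m : nat) (f : pts m -> R) : Prop :=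
  forall (x : pts m) (b : 'I_m -> 'M[R]_n), GLt x -> (forall i, upper_inv (b i)) ->
    f (fun i => x i *m b i) = f x.

Definition measurable_cochain (m : nat) (f : pts m -> R) : Prop :=
  forall a : R, tborel [set x | GLt x /\ f x < a].

Definition ess_bounded (m : nat) (f : pts m -> R) : Prop :=
  exists C : R, tnull [set x | GLt x /\ C < `|f x|].

(* equivariance for the coefficient module R_eps (a.e., as in L^infty) *)
Definition eps_equivariant (m : nat) (f : pts m -> R) : Prop :=
  forall g : 'M[R]_n, g \in unitmx ->
    tnull [set x | GLt x /\ f (fun i => g *m x i) <> Num.sg (\det g) * f x].

(* representatives of GL_n(R)-equivariant elements of L^infty(F^m, R_eps) *)
Definition Linf_eq (m : nat) (f : pts m -> R) : Prop :=
  [/\ flag_fun f, measurable_cochain f, ess_bounded f & eps_equivariant f].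

Definition esssup (m : nat) (f : pts m -> R) : R :=
  inf [set C : R | 0 <= C /\ tnull [set x | GLt x /\ C < `|f x|]].

Definition coboundary (m : nat) (h : pts m -> R) : pts m.+1 -> R :=
  fun x => \sum_(i < m.+1) (-1) ^+ i * h (fun j => x (lift i j)).

Definition spanmx (W : seq 'rV[R]_n) : 'M[R]_(size W, n) :=
  \matrix_(i < size W, j < n) (nth 0 W i) 0 j.

Definition flagvecs (M : 'M[R]_n) : seq 'rV[R]_n :=
  [seq (col j M)^T | j <- enum 'I_n].

(* [W, F]: W (ordered positive basis) followed by a vector of (F^d)^+,
   where d is the least index with F^d not contained in W *)
Definition bracket_step (W : seq 'rV[R]_n) (M : 'M[R]_n) : seq 'rV[R]_n :=
  let vs := flagvecs M in
  rcons W (nth 0 vs (find (fun v : 'rV[R]_n => ~~ (v <= spanmx W)%MS) vs)).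

Definition bracket (Ms : seq 'M[R]_n) : seq 'rV[R]_n :=
  foldl bracket_step [::] Ms.

Definition Or (W : seq 'rV[R]_n) : R :=
  Num.sg (\det (\matrix_(i < n, j < n) (nth 0 W i) 0 j)).

Definition Ecoc (x : pts n.+1) : R :=
  \prod_(i < n.+1) Or (bracket [seq x (lift i j) | j <- enum 'I_n]).

(* average over all oriented lifts of the flags *)
Definition Acoc (x : pts n.+1) : R :=
  (2%:R ^- (n * n.+1)) *
  \sum_(s : {ffun 'I_n.+1 * 'I_n -> bool})
     Ecoc (fun i => x i *m diag_mx (\row_j (if s (i, j) then -1 else 1))).

Definition normA : R :=
  inf [set esssup (fun x => Acoc x + coboundary h x) | h in [set h | Linf_eq h]].

End BoundedCohomologyGLn.

(* Main.v *)
Require Import Defs.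
From HB Require Import structures.
From mathcomp Require Import all_boot all_order all_algebra.
From mathcomp Require Import all_classical all_reals.
From mathcomp Require Import all_analysis measurable_realfun.
From mathcomp Require Import perm ring lra zify.

(* For n even and lines in general position, A is the product of the signs of the
   determinants of n of the n+1 lines; in particular |A| <= 1 everywhere, which gives the
   upper bound (with h = 0).

   Lower bound: let f = A + dh. Put e_0, ..., e_(n-1) the standard basis, e_n = - sum e_l
   (indices mod n+1), and let F_j be the flag of e_j, e_(j+1), ..., e_(j+n-1). The reflection
   g_i with e_(i-1) |-> - e_(i-1) and fixing e_l for l <> i-1, i stabilises every F_j with
   j <> i. If h were defined everywhere, equivariance under g_i, of determinant -1, would
   force h to vanish on each of the n-tuples omitting F_i, hence f(F_0, ..., F_n) = A(F_0,
   ..., F_n) = 1 or -1. As h is only defined almost everywhere, we average f over nearby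
   points instead: the g_i (i <> j) lie in a group of integer upper triangular matrices (in
   the basis of F_j), acting on a generic flag y_j close to F_j. That group is amenable,
   so averaging over explicit Folner boxes makes the contribution of h small, while A stays
   constant as soon as y_j is close enough to F_j. *)

Set Implicit Arguments. Unset Strict Implicit. Unset Printing Implicit Defensive.
Import Order.TTheory GRing.Theory Num.Theory numFieldNormedType.Exports.
Local Open Scope classical_set_scope.
Local Open Scope ring_scope.

(** * Null sets *)

Lemma measurable_segment_indicator (R : realType) (a lo hi : R) :
  measurable_fun [set: R] (fun t : R => (a * (lo <= t <= hi)%R%:R)%:E).
Proof.
apply/measurable_EFinP; apply: measurable_funM => //.
have -> : (fun t : R => (lo <= t <= hi)%R%:R : R) = \1_`[lo, hi].
  by apply/funext => t; rewrite indicE mem_setE in_itv.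
exact: measurable_indic.
Qed.

Lemma integral_segment_indicator (R : realType) (a lo hi : R) : 0 <= a ->
  (\int[@lebesgue_measure R]_t (a * (lo <= t <= hi)%R%:R)%:E
     = (a * Num.max 0 (hi - lo))%:E)%E.
Proof.
move=> a0.
have -> : (fun t : R => (a * (lo <= t <= hi)%R%:R)%:E)
        = (fun t => a%:E * (\1_`[lo, hi] t)%:E)%E.
  by apply/funext => t; rewrite indicE mem_setE in_itv EFinM.
rewrite ge0_integralZl_EFin //; last first.
  by apply/measurable_EFinP; exact: measurable_indic.
rewrite integral_indic //= setIT lebesgue_measure_itv /= lte_fin EFinM.
congr (_ * _)%E; case: ltP => h.
  by rewrite -EFinB max_r // subr_ge0 ltW.
by rewrite max_l // subr_le0.
Qed.

(** Integrate over [t] and exchange the integral with the series, whose terms are nonnegative. *)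
Lemma segment_cover_length (R : realType) (c : R) (a : nat -> R) (lo0 hi0 : R)
    (lo hi : nat -> R) :
  0 <= c -> (forall j, 0 <= a j) ->
  (forall t, (c * (lo0 <= t <= hi0)%R%:R)%:E
     <= \sum_(j <oo) (a j * (lo j <= t <= hi j)%R%:R)%:E)%E ->
  ((c * Num.max 0 (hi0 - lo0))%:E
     <= \sum_(j <oo) (a j * Num.max 0 (hi j - lo j))%:E)%E.
Proof.
move=> c0 a0 cov; rewrite -integral_segment_indicator //.
under eq_eseriesr do rewrite -integral_segment_indicator //.
have pos : forall (b l h t : R), 0 <= b -> (0 <= (b * (l <= t <= h)%R%:R)%:E)%E.
  by move=> b l h t b0; rewrite lee_fin mulr_ge0.
rewrite -integral_nneseries //=; last first.
- by move=> j t _; exact: pos.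
- by move=> j; exact: measurable_segment_indicator.
apply: ge0_le_integral => //.
- by move=> t _; exact: pos.
- exact: measurable_segment_indicator.
- by apply: ge0_emeasurable_sum => [k t _ _|k _];
    [exact: pos|exact: measurable_segment_indicator].
Qed.

(* Fubini by hand: integrate the inequality of indicator functions in one
   coordinate after the other. *)
Lemma box_cover_series (R : realType) (I : finType) (ps : seq I)
    (c : R) (a : nat -> R) (lo0 hi0 : I -> R) (lo hi : nat -> I -> R) :
  uniq ps -> 0 <= c -> (forall j, 0 <= a j) ->
  (forall x : I -> R, (c * \prod_(p <- ps) (lo0 p <= x p <= hi0 p)%R%:R)%:E
     <= \sum_(j <oo) (a j * \prod_(p <- ps) (lo j p <= x p <= hi j p)%R%:R)%:E)%E ->
  ((c * \prod_(p <- ps) Num.max 0 (hi0 p - lo0 p))%:E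
     <= \sum_(j <oo) (a j * \prod_(p <- ps) Num.max 0 (hi j p - lo j p))%:E)%E.
Proof.
elim: ps c a => [|p ps IH] c a.
  move=> _ c0 a0 /(_ (fun=> 0)); rewrite !big_nil => /le_trans; apply.
  apply: lee_nneseries => [j _ _|j _]; last by rewrite !big_nil.
  by rewrite big_nil mulr1 lee_fin.
move=> /= /andP[pps ups] c0 a0 cov.
under eq_eseriesr do rewrite big_cons mulrA.
(* The side lengths in coordinate [p] are absorbed into the coefficients, which is why [c] and [a]
   are arbitrary. *)
rewrite big_cons mulrA; apply: IH => //.
- by rewrite mulr_ge0 // le_max lexx.
- by move=> j; rewrite mulr_ge0 // le_max lexx.
move=> x.
have other (q : I) t : q \in ps -> (if q == p then t else x q) = x q.
  by move=> qps; case: eqP => // qp; rewrite -qp qps in pps.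
under eq_eseriesr do rewrite mulrAC.
rewrite mulrAC; apply: segment_cover_length.
- by rewrite mulr_ge0 // prodr_ge0.
- by move=> j; rewrite mulr_ge0 // prodr_ge0.
move=> t; have := cov (fun q => if q == p then t else x q).
rewrite big_cons eqxx mulrCA mulrC.
rewrite (eq_big_seq (fun q => (lo0 q <= x q <= hi0 q)%R%:R)); last first.
  by move=> q qps /=; rewrite other.
move=> /le_trans; apply; apply: lee_nneseries => [j _ _|j _].
  by rewrite lee_fin mulr_ge0 // prodr_ge0.
rewrite big_cons eqxx mulrCA mulrC lee_fin.
rewrite (eq_big_seq (fun q => (lo j q <= x q <= hi j q)%R%:R)) //.
by move=> q qps /=; rewrite other.
Qed.

Lemma box_indicator (R : realType) (I : finType) (lo hi x : I -> R) :
  \prod_(p <- enum I) (lo p <= x p <= hi p)%R%:R = (`[< box lo hi x >])%:R :> R.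
Proof.
case: asboolP => [xb|nxb].
  by rewrite big1_seq // => p _; rewrite xb.
have [p /negP np] : exists p, ~ (lo p <= x p <= hi p) by apply/existsNP.
by rewrite (big_rem p) ?mem_enum //= (negbTE np) mul0r.
Qed.

(** A cover of total volume at most half that of the box would contradict [box_cover_series] with
    all coefficients 1. *)
Lemma box_not_null (R : realType) (I : finType) (lo hi : I -> R) :
  (forall p, lo p < hi p) -> ~ lnull (box lo hi).
Proof.
move=> lohi nul.
have volE (l h : I -> R) : boxvol l h = \prod_(p <- enum I) Num.max 0 (h p - l p).
  by rewrite /boxvol big_enum.
have vpos : 0 < boxvol lo hi.
  by apply: prodr_gt0 => p _; rewrite lt_max subr_gt0 lohi orbT.
have vge0 (l h : I -> R) : 0 <= boxvol l h.
  by apply: prodr_ge0 => p _; rewrite le_max lexx.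
have [l [h [cov small]]] := nul _ (divr_gt0 vpos (ltr0n R 2)).
have : ((1 * boxvol lo hi)%:E <= \sum_(j <oo) (1 * boxvol (l j) (h j))%:E)%E.
  rewrite volE; under eq_eseriesr do rewrite volE.
  apply: (@box_cover_series _ _ _ _ (fun=> 1)) => //; first exact: enum_uniq.
  move=> x; rewrite box_indicator; under eq_eseriesr do rewrite box_indicator.
  have pos j : (0 <= (1 * (`[< box (l j) (h j) x >])%:R : R)%:E)%E.
    by rewrite mul1r lee_fin.
  case: (asboolP (box lo hi x)) => [/cov[j _ xj]|_]; last first.
    by rewrite mulr0; apply: nneseries_ge0.
  apply: le_trans (nneseries_lim_ge j.+1 _) => //.
  rewrite big_nat_recr //= -[leLHS]add0e; apply: leeD; last by rewrite asboolT.
  exact: sume_ge0.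
rewrite mul1r; under eq_eseriesr do rewrite mul1r.
have : (\sum_(j <oo) (boxvol (l j) (h j))%:E <= (boxvol lo hi / 2)%:E)%E.
  apply: lime_le; first by apply: is_cvg_nneseries => j _ _; rewrite lee_fin.
  by apply: nearW => N; rewrite sumEFin lee_fin big_mkord.
move=> /[swap] /le_trans/[apply]; rewrite lee_fin; lra.
Qed.

(** * Stability of null sets under unions, cylinders and preimages *)

Lemma sum_subset_uniq (R : numDomainType) (T : eqType) (w : T -> R) (xs ys : seq T) :
  (forall x, 0 <= w x) -> uniq xs -> {subset xs <= ys} ->
  \sum_(x <- xs) w x <= \sum_(y <- ys) w y.
Proof.
move=> w0; elim: xs ys => [|x xs IH] ys /=; first by rewrite big_nil sumr_ge0.
move=> /andP[xxs uxs] sub; rewrite big_cons [leRHS](big_rem x) ?sub ?mem_head //= lerD2l.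
apply: IH => // y yxs; apply: rem_mem; last by rewrite sub // inE yxs orbT.
by apply: contraNneq xxs => <-.
Qed.

Lemma boxvol_ge0 (R : realType) (I : finType) (lo hi : I -> R) : 0 <= boxvol lo hi.
Proof. by apply: prodr_ge0 => p _; rewrite le_max lexx. Qed.

Lemma empty_boxvol (R : realType) (I : finType) (i0 : I) :
  boxvol (fun _ : I => 1) (fun _ : I => 0 : R) = 0.
Proof. by rewrite /boxvol (bigD1 i0) //= sub0r max_l ?mul0r // lerN10. Qed.

(* The index set must be inhabited: for [I] empty every box has volume [1]. *)
Lemma lnull_pairs (R : realType) (I : finType) (i0 : I) (S : set (I -> R)) :
  (forall e : R, 0 < e -> exists lo hi : nat -> nat -> I -> R,
     S `<=` \bigcup_j \bigcup_k box (lo j k) (hi j k) /\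
     forall N M, \sum_(j < N) \sum_(k < M) boxvol (lo j k) (hi j k) <= e) ->
  lnull S.
Proof.
move=> H e /H[lo [hi [cov small]]].
pose inv m : option (nat * nat) := pickle_inv m.
(* Numbers that code no pair receive the box with [lo = 1] and [hi = 0], which is empty and of
   volume 0. *)
exists (fun m => if inv m is Some x then lo x.1 x.2 else fun=> 1).
exists (fun m => if inv m is Some x then hi x.1 x.2 else fun=> 0).
split=> [x /cov[j _ [k _ xjk]]|N].
  by exists (pickle (j, k)) => //; rewrite /inv pickleK_inv.
pose w (x : nat * nat) := boxvol (lo x.1 x.2) (hi x.1 x.2).
pose xs := pmap inv (iota 0 N).
have -> : \sum_(m < N) boxvol (if inv m is Some x then lo x.1 x.2 else fun=> 1)
    (if inv m is Some x then hi x.1 x.2 else fun=> 0) = \sum_(x <- xs) w x.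
  rewrite -(big_mkord xpredT (fun m => boxvol (if inv m is Some x then lo x.1 x.2
    else fun=> 1) (if inv m is Some x then hi x.1 x.2 else fun=> 0))) /xs.
  rewrite /index_iota subn0; elim: (iota 0 N) => [|m s IHs]; first by rewrite !big_nil.
  rewrite big_cons IHs /=; case: (inv m) => [x|] /=; first by rewrite big_cons.
  by rewrite empty_boxvol // add0r.
have uxs : uniq xs by apply: (@pmap_uniq _ _ _ pickle); [exact: pickle_invK|exact: iota_uniq].
(* The pairs coded below [N] all lie in a rectangle of size [J] by [K], whose sum the hypothesis
   bounds. *)
pose J := (\max_(x <- xs) x.1).+1; pose K := (\max_(x <- xs) x.2).+1.
apply: le_trans (small J K).
have -> : \sum_(j < J) \sum_(k < K) boxvol (lo j k) (hi j k)
    = \sum_(x <- [seq (j, k) | j <- iota 0 J, k <- iota 0 K]) w x.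
  have io n (F : nat -> R) : \sum_(j < n) F j = \sum_(j <- iota 0 n) F j.
    by rewrite -(big_mkord xpredT) /index_iota subn0.
  rewrite big_allpairs (io J (fun j => \sum_(k < K) boxvol (lo j k) (hi j k))).
  by apply: eq_bigr => j _; rewrite (io K (fun k => boxvol (lo j k) (hi j k))).
apply: sum_subset_uniq => // [x|[j k] jk]; first exact: boxvol_ge0.
apply/allpairsP; exists (j, k); rewrite !mem_iota /= !ltnS; split => //.
  exact: (@leq_bigmax_seq _ _ xpredT (fun x : nat * nat => x.1) _ jk).
exact: (@leq_bigmax_seq _ _ xpredT (fun x : nat * nat => x.2) _ jk).
Qed.

Lemma sum_half_powers (R : realType) (e : R) N :
  0 <= e -> \sum_(k < N) e / 2 ^+ k.+1 <= e.
Proof.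
move=> e0; suff -> : \sum_(k < N) e / 2 ^+ k.+1 = e - e / 2 ^+ N.
  by rewrite gerBl divr_ge0 // exprn_ge0.
elim: N => [|N IH]; first by rewrite big_ord0 expr0 divr1 subrr.
rewrite big_ord_recr /= IH exprS; field.
by rewrite expf_neq0 // pnatr_eq0.
Qed.

Lemma lnull_sub (R : realType) (I : finType) (S T : set (I -> R)) :
  S `<=` T -> lnull T -> lnull S.
Proof.
by move=> ST nT e /nT[lo [hi [cov small]]]; exists lo, hi; split => // x /ST/cov.
Qed.

Lemma lnull_set0 (R : realType) (I : finType) (i0 : I) : lnull (set0 : set (I -> R)).
Proof.
move=> e e0; exists (fun _ _ => 1), (fun _ _ => 0); split => // N.
by rewrite big1 ?ltW // => j _; exact: empty_boxvol.
Qed.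

Lemma lnull_bigcup (R : realType) (I : finType) (i0 : I) (S : nat -> set (I -> R)) :
  (forall k, lnull (S k)) -> lnull (\bigcup_k S k).
Proof.
move=> nS; apply: lnull_pairs => // e e0.
have pos k : 0 < e / 2 ^+ k.+1 by rewrite divr_gt0 // exprn_gt0.
have /choice[b cov] k : exists b : (nat -> I -> R) * (nat -> I -> R),
    S k `<=` \bigcup_j box (b.1 j) (b.2 j) /\
    forall N, \sum_(j < N) boxvol (b.1 j) (b.2 j) <= e / 2 ^+ k.+1.
  by have [lo [hi H]] := nS k _ (pos k); exists (lo, hi).
exists (fun k => (b k).1), (fun k => (b k).2); split => [x [k _ /(cov k).1]|N M].
  by exists k.
apply: le_trans (sum_half_powers N (ltW e0)); apply: ler_sum => k _.
exact: (cov k).2.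
Qed.

Lemma lnull_bigcup_count (R : realType) (I : finType) (i0 : I) (K : countType)
    (S : K -> set (I -> R)) :
  (forall k, lnull (S k)) -> lnull (\bigcup_k S k).
Proof.
move=> nS.
apply: (@lnull_sub _ _ _ (\bigcup_m if pickle_inv m is Some k then S k else set0)).
  by move=> x [k _ xk]; exists (pickle k) => //; rewrite pickleK_inv.
apply: lnull_bigcup => // m; case: pickle_inv => [k|]; first exact: nS.
exact: lnull_set0.
Qed.

Lemma lnull_setU (R : realType) (I : finType) (i0 : I) (S T : set (I -> R)) :
  lnull S -> lnull T -> lnull (S `|` T).
Proof.
move=> nS nT; apply: (@lnull_sub _ _ _ (\bigcup_b if b then S else T)).
  by move=> x [xS|xT]; [exists true|exists false].
by apply: lnull_bigcup_count => // -[].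
Qed.

(** The coordinates outside the image of [f] are free. Restricting to [|x i| <= N] makes them
    contribute a constant factor to volumes, and the union over [N] recovers the cylinder. *)
Lemma lnull_cylinder (R : realType) (I J : finType) (i0 : I) (f : J -> I)
    (S : set (J -> R)) :
  injective f -> lnull S -> lnull [set x : I -> R | S (x \o f)].
Proof.
move=> fI nS.
apply: (@lnull_sub _ _ _
  (\bigcup_N [set x : I -> R | S (x \o f) /\ forall i, `|x i| <= N%:R])).
  move=> x Sx; exists (Num.bound (\sum_i `|x i|)) => //; split => // i.
  apply: le_trans (ltW (archi_boundP _)); last exact: sumr_ge0.
  by rewrite (bigD1 i) //= lerDl sumr_ge0.
apply: lnull_bigcup => // N e e0.
(* The summand 1 keeps [w] positive when [N = 0]. *)
pose w : R := (2 * N%:R) ^+ #|[predC codom f]| + 1.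
have w0 : 0 < w by rewrite ltr_wpDl // exprn_ge0 // mulr_ge0.
have [lo [hi [cov small]]] := nS _ (divr_gt0 e0 w0).
pose ext (d : R) (l : J -> R) i := if [pick q | f q == i] is Some q then l q else d.
have extf d l q : ext d l (f q) = l q.
  by rewrite /ext; case: pickP => [r /eqP/fI->//|/(_ q)]; rewrite eqxx.
have extN d l i : i \notin codom f -> ext d l i = d.
  by rewrite /ext; case: pickP => // r /eqP <-; rewrite codom_f.
exists (fun j => ext (- N%:R) (lo j)), (fun j => ext N%:R (hi j)).
split => [x [/= /cov[j _ xj] xN]|M].
  exists j => // i; have [|ic] := boolP (i \in codom f).
    by case/codomP => q ->; rewrite !extf; exact: xj.
  by rewrite !extN // -ler_norml.
have vol j : boxvol (ext (- N%:R) (lo j)) (ext N%:R (hi j)) <= w * boxvol (lo j) (hi j).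
  rewrite /boxvol (bigID (mem (codom f))) /=.
  rewrite (_ : \prod_(i in codom f) _ = boxvol (lo j) (hi j)); last first.
    rewrite -big_uniq; last by rewrite map_inj_uniq // enum_uniq.
    by rewrite big_image /=; apply: eq_bigr => q _; rewrite !extf.
  rewrite mulrC ler_wpM2r ?boxvol_ge0 //.
  rewrite (eq_bigr (fun=> 2 * N%:R)); last first.
    by move=> i ic; rewrite !extN // opprK -mulr2n mulr_natl max_r // mulrn_wge0.
  by rewrite prodr_const lerDl.
apply: (@le_trans _ _ (\sum_(j < M) w * boxvol (lo j) (hi j))).
  by apply: ler_sum => j _; exact: vol.
by rewrite -mulr_sumr -ler_pdivlMl // mulrC small.
Qed.

(** The difference is a polynomial in [d] without constant term, and on [[0, 1]] higher powers are
    dominated by [d]. It bounds the volume gained when the sides of a box grow by [d]. *)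
Lemma prod_add_small (R : realType) (I : Type) (s : seq I) (l : I -> R) :
  (forall i, 0 <= l i) ->
  exists2 C, 0 <= C & forall d, 0 <= d <= 1 ->
    \prod_(i <- s) (l i + d) <= \prod_(i <- s) l i + C * d.
Proof.
move=> l0; elim: s => [|i s [C C0 H]]; first by exists 0 => // d _; rewrite !big_nil; lra.
have P0 : 0 <= \prod_(i <- s) l i by apply: prodr_ge0.
exists (l i * C + \prod_(i <- s) l i + C) => [|d dd].
  by rewrite addr_ge0 // addr_ge0 // mulr_ge0.
rewrite !big_cons; have := H d dd; case/andP: dd => d0 d1 Hd.
have := l0 i; move: (\prod_(j <- s) (l j + d)) (\prod_(j <- s) l j) (l i) P0 Hd => Q P L P0 Hd L0.
apply: (@le_trans _ _ ((L + d) * (P + C * d))).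
  by rewrite ler_wpM2l // addr_ge0.
have : C * d * d <= C * d by rewrite ler_piMr // mulr_ge0.
lra.
Qed.

Lemma sum_nth_le (R : numDomainType) (T : Type) (v : T -> R) (x0 : T) (s : seq T) M :
  (forall x, 0 <= v x) -> v x0 = 0 ->
  \sum_(k < M) v (nth x0 s k) <= \sum_(x <- s) v x.
Proof.
move=> v0 vx0; elim: s M => [|x s IH] [|M].
- by rewrite big_ord0 big_nil.
- by rewrite big_nil big1 // => k _; rewrite nth_nil.
- by rewrite big_ord0 sumr_ge0.
- by rewrite big_ord_recl big_cons lerD2l; exact: IH.
Qed.

(* [hT] says that [T] is injective with a [K]-Lipschitz inverse for the sup norm.
   The box is cut into small cubes, whose preimages lie in cubes [2 K] times as large. *)
Lemma box_preimage_cover (R : realType) (I : finType) (i0 : I)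
    (T : (I -> R) -> I -> R) (K eta : R) (lo hi : I -> R) :
  0 < K -> 0 < eta ->
  (forall x y c, (forall p, `|T x p - T y p| <= c) -> forall p, `|x p - y p| <= K * c) ->
  exists bs : seq ((I -> R) * (I -> R)),
    (forall x, box lo hi (T x) -> exists k,
       box (nth (fun=> 1, fun=> 0) bs k).1 (nth (fun=> 1, fun=> 0) bs k).2 x) /\
    \sum_(b <- bs) boxvol b.1 b.2 <= (2 * K) ^+ #|I| * (boxvol lo hi + eta).
Proof.
move=> K0 eta0 hT; pose l p := Num.max 0 (hi p - lo p).
have l0 p : 0 <= l p by rewrite le_max lexx.
have [C C0 HC] := prod_add_small (index_enum I) l0.
(* The mesh: at most 1 for [prod_add_small], and small enough for [C * d <= eta]. *)
pose d := Num.min 1 (eta / (C + 1)).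
have C1 : 0 < C + 1 by rewrite ltr_wpDl.
have d0 : 0 < d by rewrite lt_min ltr01 divr_gt0.
have Cd : C * d <= eta.
  apply: (@le_trans _ _ ((C + 1) * d)); first by rewrite ler_wpM2r ?lerDl // ltW.
  by rewrite mulrC -ler_pdivlMr // ge_min lexx orbT.
pose M p := (Num.truncn (l p / d)).+1.
have Md p : (M p)%:R * d <= l p + d.
  rewrite /M -natr1 mulrDl mul1r lerD2r -ler_pdivlMr //.
  by apply: (andP (truncn_itv _)).1; rewrite divr_ge0 // ltW.
(* A common bound on the numbers [M p] of cells per direction lets one finite type index the cells;
   [F] keeps those with [f p < M p]. *)
pose B := (\max_p M p).+1.
have MB p : (M p <= B)%N by apply: leqW; exact: leq_bigmax.
pose cube (f : {ffun I -> 'I_B}) (y : I -> R) :=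
  forall p, lo p + (f p)%:R * d <= y p <= lo p + (f p)%:R * d + d.
pose F := family (fun p => [pred k : 'I_B | (k < M p)%N]).
(* The preimage of a cell lies within [K * d] of any one of its points; if it has none, it gets an
   empty box. *)
pose b (f : {ffun I -> 'I_B}) : (I -> R) * (I -> R) :=
  if pselect (exists x, cube f (T x)) is left h then
    (fun p => sval (cid h) p - K * d, fun p => sval (cid h) p + K * d)
  else (fun=> 1, fun=> 0).
exists [seq b f | f <- enum F]; split=> [x xb|].
  have lt p : (Num.truncn ((T x p - lo p) / d) < M p)%N.
    rewrite ltnS; apply: le_truncn; rewrite ler_pM2r ?invr_gt0 // /l le_max lerD2r.
    by case/andP: (xb p) => _ ->; rewrite orbT.
  pose f : {ffun I -> 'I_B} := [ffun p => Ordinal (leq_trans (lt p) (MB p))].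
  have fF : f \in enum F.
    by rewrite mem_enum; apply/familyP => p; rewrite inE ffunE /=.
  have cf : cube f (T x).
    move=> p; rewrite ffunE /=; set q := (T x p - lo p) / d.
    have xE : T x p = lo p + q * d by rewrite /q divfK ?gt_eqF // addrC subrK.
    have /andP[q1 q2] : (Num.truncn q)%:R <= q < (Num.truncn q).+1%:R.
      apply: truncn_itv; rewrite divr_ge0 ?(ltW d0) // subr_ge0.
      by case/andP: (xb p).
    rewrite xE lerD2l ler_pM2r // q1 /= -addrA lerD2l.
    by move: (ltW q2); rewrite -natr1 -(ler_pM2r d0) mulrDl mul1r.
  exists (index f (enum F)); rewrite (nth_map f) ?index_mem // nth_index //.
  rewrite /b; case: pselect => [h|/(_ (ex_intro _ x cf))//] p /=.
  have := hT x (sval (cid h)) d; have := svalP (cid h).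
  move: (sval _) => z cz /(_ _ p); rewrite ler_distl; apply.
  by move=> r; rewrite ler_norml; have := cf r; have := cz r; lra.
rewrite big_map (le_trans (y := \sum_(f <- enum F) \prod_(p : I) (2 * K * d))) //.
  apply: ler_sum => f _; rewrite /b; case: pselect => h /=; last first.
    by rewrite empty_boxvol // prodr_ge0 // => p _; rewrite !mulr_ge0 // ltW.
  apply: ler_prod => p _; rewrite le_max lexx /= ge_max; apply/andP; split.
    by rewrite !mulr_ge0 // ltW.
  lra.
(* By distributivity the sum over cells becomes a product over [p] of [M p] times [2 * K * d]. *)
rewrite big_enum /= -(bigA_distr_big_dep _ (fun p k => 2 * K * d)).
rewrite -prodr_const; apply: le_trans (_ : \prod_p (2 * K * (l p + d)) <= _).
  apply: ler_prod => p _; rewrite (big_ord_narrow (MB p)) sumr_const card_ord.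
  rewrite mulrn_wge0 ?mulr_ge0 ?(ltW K0) ?(ltW d0) //= -[leLHS]mulr_natr -[leLHS]mulrA.
  by rewrite ler_pM2l ?mulr_gt0 // mulrC.
rewrite big_split /= ler_wpM2l //.
  by apply: prodr_ge0 => p _; rewrite mulr_ge0 // ltW.
apply: le_trans (HC d _) _; last by rewrite lerD2l.
by rewrite ltW //= ge_min lexx.
Qed.

Lemma lnull_preimage (R : realType) (I : finType) (i0 : I)
    (T : (I -> R) -> I -> R) (K : R) (S : set (I -> R)) :
  0 < K ->
  (forall x y c, (forall p, `|T x p - T y p| <= c) -> forall p, `|x p - y p| <= K * c) ->
  lnull S -> lnull [set x | S (T x)].
Proof.
move=> K0 hT nS; apply: lnull_pairs => // e e0.
pose w := (2 * K) ^+ #|I|.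
have w0 : 0 < w by rewrite exprn_gt0 // mulr_gt0.
(* Half of the budget pays for the volumes of the boxes, half for the errors [eta] of
   [box_preimage_cover]. *)
pose e1 := e / (2 * w).
have e10 : 0 < e1 by rewrite divr_gt0 // mulr_gt0.
have [lo [hi [cov small]]] := nS _ e10.
have eta0 j : 0 < e1 / 2 ^+ j.+1 by rewrite divr_gt0 // exprn_gt0.
have /choice[bs H] j := box_preimage_cover i0 (lo j) (hi j) K0 (eta0 j) hT.
exists (fun j k => (nth (fun=> 1, fun=> 0) (bs j) k).1).
exists (fun j k => (nth (fun=> 1, fun=> 0) (bs j) k).2).
split=> [x /cov[j _ /(H j).1[k xk]]|N M]; first by exists j => //; exists k.
apply: (@le_trans _ _ (\sum_(j < N) w * (boxvol (lo j) (hi j) + e1 / 2 ^+ j.+1))).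
  apply: ler_sum => j _; apply: le_trans (H j).2.
  apply: (sum_nth_le (v := fun b => boxvol b.1 b.2)) => [b|]; first exact: boxvol_ge0.
  exact: empty_boxvol.
rewrite -mulr_sumr big_split /=.
have -> : e = w * (e1 + e1) by rewrite /e1; field; rewrite gt_eqF.
by rewrite ler_pM2l // lerD ?small // sum_half_powers // ltW.
Qed.

(** * Averages over boxes of integer families *)

Definition upd (P : eqType) (g : P -> int) (p : P) (t : int) : P -> int :=
  fun q => if q == p then t else g q.

Definition avg1 (R : realType) (P : eqType) (V : P -> seq int) (p : P)
    (u : (P -> int) -> R) : (P -> int) -> R :=
  fun g => (size (V p))%:R^-1 * \sum_(t <- V p) u (upd g p t).

(** Entries outside [ps] keep the values they have in the argument; nesting gives access to one
    entry at a time. *)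
Definition avg (R : realType) (P : eqType) (V : P -> seq int) (ps : seq P)
    (u : (P -> int) -> R) : (P -> int) -> R := foldr (avg1 V) u ps.

Lemma updC (P : eqType) (g : P -> int) p q s t :
  p != q -> upd (upd g p s) q t = upd (upd g q t) p s.
Proof.
move=> pq; apply/funext => r; rewrite /upd.
by case: (eqVneq r q) => // ->; rewrite eq_sym (negbTE pq).
Qed.

Lemma avg1C (R : realType) (P : eqType) (V : P -> seq int) p q (u : (P -> int) -> R) :
  avg1 V p (avg1 V q u) = avg1 V q (avg1 V p u).
Proof.
case: (eqVneq p q) => [->//|pq]; apply/funext => g; rewrite /avg1.
rewrite -!mulr_sumr mulrCA exchange_big /=; congr (_ * (_ * _)).
by apply: eq_bigr => t _; apply: eq_bigr => s _; rewrite updC.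
Qed.

(** Averages over different entries commute, so [p] can be averaged innermost. *)
Lemma avg_rem (R : realType) (P : eqType) (V : P -> seq int) ps p (u : (P -> int) -> R) :
  p \in ps -> avg V ps u = avg V (rem p ps) (avg1 V p u).
Proof.
elim: ps => //= q ps IH; rewrite inE; case: (eqVneq p q) => [-> _|pq /= pps].
  by elim: ps {IH} => //= r ps IH; rewrite avg1C IH.
by rewrite IH.
Qed.

Lemma avg_between (R : realType) (P : eqType) (V : P -> seq int) ps
    (u : (P -> int) -> R) (a b : R) (g0 : P -> int) :
  (forall p, g0 p \in V p) ->
  (forall g, (forall p, g p \in V p) -> a <= u g <= b) -> a <= avg V ps u g0 <= b.
Proof.
move=> g0V uab; elim: ps g0 g0V => [|p ps IH] g0 g0V /=; first exact: uab.
(* The value [g0 p] shows that the range is not empty. *)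
have V0 : 0 < (size (V p))%:R :> R by rewrite ltr0n; case: (V p) (g0V p).
have h t : t \in V p -> a <= avg V ps u (upd g0 p t) <= b.
  by move=> tV; apply: IH => q; rewrite /upd; case: eqP => // ->.
have cst (c : R) : c * (size (V p))%:R = \sum_(t <- V p) c.
  by rewrite big_const_seq count_predT iter_addr_0 mulr_natr.
rewrite /avg1 mulrC ler_pdivlMr // ler_pdivrMr // !cst !big_seq.
by apply/andP; split; apply: ler_sum => t /h/andP[].
Qed.

Lemma avg_eq (R : realType) (P : eqType) (V : P -> seq int) ps
    (u : (P -> int) -> R) (a : R) (g0 : P -> int) :
  (forall p, g0 p \in V p) ->
  (forall g, (forall p, g p \in V p) -> u g = a) -> avg V ps u g0 = a.
Proof.
move=> g0V ua; apply/eqP; rewrite eq_le andbC.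
by apply: avg_between => // g /ua ->; rewrite lexx.
Qed.

Lemma avg_norm (R : realType) (P : eqType) (V : P -> seq int) ps
    (u : (P -> int) -> R) (a : R) (g0 : P -> int) :
  (forall p, g0 p \in V p) ->
  (forall g, (forall p, g p \in V p) -> `|u g| <= a) -> `|avg V ps u g0| <= a.
Proof.
move=> g0V ua; rewrite ler_norml; apply: avg_between => // g /ua.
by rewrite ler_norml.
Qed.

Lemma avgD (R : realType) (P : eqType) (V : P -> seq int) ps
    (u w : (P -> int) -> R) :
  avg V ps (fun g => u g + w g) = (fun g => avg V ps u g + avg V ps w g).
Proof.
elim: ps => //= p ps ->; apply/funext => g.
by rewrite /avg1 -mulrDr -big_split.
Qed.

Lemma avgZ (R : realType) (P : eqType) (V : P -> seq int) ps c
    (u : (P -> int) -> R) :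
  avg V ps (fun g => c * u g) = (fun g => c * avg V ps u g).
Proof.
elim: ps => //= p ps ->; apply/funext => g.
by rewrite /avg1 -mulr_sumr mulrCA.
Qed.

Lemma avg_sum (R : realType) (P : eqType) (V : P -> seq int) ps k
    (u : 'I_k -> (P -> int) -> R) g0 : (forall p, g0 p \in V p) ->
  avg V ps (fun g => \sum_(i < k) u i g) g0 = \sum_(i < k) avg V ps (u i) g0.
Proof.
move=> g0V; elim: k u => [|k IH] u.
  by rewrite big_ord0; apply: avg_eq => // g _; rewrite big_ord0.
rewrite (_ : (fun g => _) = fun g => \sum_(i < k) u (widen_ord (leqnSn k) i) g + u ord_max g).
  by rewrite avgD IH big_ord_recr.
by apply/funext => g; rewrite big_ord_recr.
Qed.

(** * Almost invariance of the boxes under the row moves *)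

Definition segment (L : nat) : seq int := [seq k%:Z - L%:Z | k <- iota 0 (L.*2.+1)].

Lemma size_segment L : size (segment L) = L.*2.+1.
Proof. by rewrite size_map size_iota. Qed.

Lemma mem_segment L t : t \in segment L -> `|t| <= L%:Z.
Proof. by case/mapP => k; rewrite mem_iota => h ->; lia. Qed.

Lemma segment0 L : 0 \in segment L.
Proof. by apply/mapP; exists L; rewrite ?subrr // mem_iota; lia. Qed.

Lemma big_segment (R : zmodType) (u : int -> R) L :
  \sum_(t <- segment L) u t = \sum_(k < L.*2.+1) u (k%:Z - L%:Z).
Proof. by rewrite big_map -(big_mkord xpredT (fun k => u (k%:Z - L%:Z))) /index_iota subn0. Qed.

Lemma segment_reflect (R : zmodType) (u : int -> R) L :
  \sum_(t <- segment L) u (- t) = \sum_(t <- segment L) u t.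
Proof.
rewrite !big_segment [RHS](reindex_inj rev_ord_inj) /=.
by apply: eq_bigr => k _; congr u; have := ltn_ord k; lia.
Qed.

(** A unit shift gains one term and loses one, at cost [2 * B]; the rest telescopes. *)
Lemma segment_shift_nat (R : realType) (u : int -> R) L B (s : nat) :
  (forall t, `|u t| <= B) ->
  `|\sum_(t <- segment L) u (t + s%:Z) - \sum_(t <- segment L) u t| <= 2 * B * s%:R.
Proof.
move=> uB; elim: s => [|s IH].
  by under eq_bigr do rewrite addr0; rewrite subrr normr0 mulr0.
have step M : \sum_(k < M) u (k%:Z - L%:Z + s.+1%:Z) - \sum_(k < M) u (k%:Z - L%:Z + s%:Z)
    = u (M%:Z - L%:Z + s%:Z) - u (s%:Z - L%:Z).
  elim: M => [|M IHM]; first by rewrite !big_ord0 subrr sub0r [- _ + _]addrC subrr.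
  rewrite !big_ord_recr /= opprD addrACA IHM.
  rewrite (_ : M.+1%:Z - L%:Z + s%:Z = M%:Z - L%:Z + s.+1%:Z); last by lia.
  by ring.
rewrite -(natr1 s) mulrDr mulr1 [leRHS]addrC.
rewrite -(subrKA (\sum_(t <- segment L) u (t + s%:Z))).
apply: le_trans (ler_normD _ _) _; apply: lerD => //.
rewrite (big_segment (fun t => u (t + s.+1%:Z))).
rewrite (big_segment (fun t => u (t + s%:Z))) step.
apply: le_trans (ler_normB _ _) _; rewrite mulr_natl mulr2n.
exact: lerD.
Qed.

(** The map [t |-> s - t] combines a reflection, which preserves the symmetric segment, with a shift
    by [s]. *)
Lemma segment_shift (R : realType) (u : int -> R) L B (s : int) :
  (forall t, `|u t| <= B) ->
  `|\sum_(t <- segment L) u (s - t) - \sum_(t <- segment L) u t| <= 2 * B * `|s|%:~R.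
Proof.
move=> uB; rewrite (segment_reflect (fun t => u (s + t))).
have -> : \sum_(t <- segment L) u (s + t) = \sum_(t <- segment L) u (t + s).
  by apply: eq_bigr => t _; rewrite addrC.
case: (lerP 0 s) => s0.
  rewrite (ger0_norm s0); case: s s0 => // m _; exact: segment_shift_nat.
have := @segment_shift_nat _ (fun t => u (t + s)) L B `|s|%N (fun t => uB _).
have -> : \sum_(t <- segment L) u (t + `|s|%N%:Z + s) = \sum_(t <- segment L) u t.
  by apply: eq_bigr => t _; congr u; lia.
by rewrite distrC (pmulrn 1 `|s|%N) abszE.
Qed.

(** The components are the index of a flag, a row and a column. *)
Definition entry (m : nat) := ('I_m.+2 * 'I_m.+1 * 'I_m.+1)%type.

(* An integer family [g] on [entry m] is read as m+2 upper triangular matrices of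
   size m+1; the weights [N ^ (b - a)] make these boxes Folner sets. *)
Definition ranges m (N : nat) (p : entry m) : seq int :=
  if (p.1.2 < p.2)%N then segment (N ^ (p.2 - p.1.2))
  else if p.1.2 == p.2 then [:: 1; -1] else [:: 0].

(** Unlike [ranges], this leaves the entries above the diagonal unbounded, so it is stable under the
    moves. *)
Definition unitri m (g : entry m -> int) : Prop :=
  forall p : entry m, ((p.2 < p.1.2)%N -> g p = 0) /\ (p.1.2 = p.2 -> g p = 1 \/ g p = -1).

(** In the last row [inord] returns a default value, which [twice_below] discards. *)
Definition below m (p : entry m) : entry m := (p.1.1, inord p.1.2.+1, p.2).

Definition twice_below m (p : entry m) (g : entry m -> int) : int :=
  if (p.1.2 < m)%N then 2 * g (below p) else 0.

(** For [qs = rows i] this is the action of g_i on all flags F_j with [j <> i], see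
    [fam_mx_rowmove]; a general list allows changing the entries one by one. *)
Definition rowmove m (qs : seq (entry m)) (g : entry m -> int) : entry m -> int :=
  fun p => if p \in qs then twice_below p g - g p else g p.

Definition move1 m (q : entry m) (g : entry m -> int) : entry m -> int :=
  upd g q (twice_below q g - g q).

(** The difference [i - p.1.1] is taken modulo m+2. In the basis of F_j the selected row is the
    coefficient of e_(i-1), the vector that g_i negates. *)
Definition rows m (i : 'I_m.+2) : seq (entry m) :=
  [seq p : entry m <- enum {: entry m} | (p.1.1 != i) && (p.1.2.+1 == i - p.1.1 :> nat)].

Lemma ranges_unitri m N (g : entry m -> int) :
  (forall p, g p \in ranges N p) -> unitri g.
Proof.
move=> gr p; have := gr p; rewrite /ranges; split=> [lt|eq].
  by move: (gr p); rewrite /ranges ltnNge (ltnW lt) /= -val_eqE gtn_eqF // inE => /eqP.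
move: (gr p); rewrite /ranges eq ltnn eqxx !inE => /orP[] /eqP ->; by [left|right].
Qed.

Lemma below_row m (p : entry m) : (p.1.2 < m)%N -> (below p).1.2 = p.1.2.+1 :> nat.
Proof. by move=> pm; rewrite /= inordK. Qed.

Lemma twice_below0 m (p : entry m) g :
  unitri g -> (p.2 <= p.1.2)%N -> twice_below p g = 0.
Proof.
rewrite /twice_below => gt le; case: ifP => // pm.
by rewrite (gt (below p)).1 ?mulr0 // below_row.
Qed.

Lemma move1_unitri m (q : entry m) g : unitri g -> unitri (move1 q g).
Proof.
move=> gt p; rewrite /move1 /upd; case: eqP => [->|_]; last exact: gt.
split=> h; first by rewrite twice_below0 ?(ltnW h) // (gt q).1 // subrr.
rewrite twice_below0 ?h // sub0r.
by case: ((gt q).2 h) => ->; [right|left; rewrite opprK].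
Qed.

(** One row down the distance to the diagonal drops by one, so the range there is smaller by a
    factor [N]. *)
Lemma twice_below_bound m N (p : entry m) g :
  (0 < N)%N -> (forall p, g p \in ranges N p) -> (p.1.2 < p.2)%N ->
  `|twice_below p g| <= (2 * N ^ (p.2 - p.1.2).-1)%N%:Z.
Proof.
move=> N0 gr lt; rewrite /twice_below; case: ifP => pm; last by rewrite normr0.
rewrite normrM PoszM ler_pM2l //; have := gr (below p).
rewrite /ranges below_row //= -subnS; case: ltnP => [_|le].
  exact: mem_segment.
have -> : inord p.1.2.+1 == p.2.
  by rewrite -val_eqE /= inordK // eqn_leq lt le.
rewrite (eqP (_ : (p.2 - p.1.2.+1)%N == 0%N)) ?subn_eq0 //.
by rewrite !inE => /orP[] /eqP ->.
Qed.

Lemma upd_upd (P : eqType) (g : P -> int) p s t : upd (upd g p s) p t = upd g p t.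
Proof. by apply/funext => q; rewrite /upd; case: eqP. Qed.

(** The entry below [q] lies in another row, so changing [q] does not affect it: in the single value
    [t] the move is a reflection. *)
Lemma move1_upd m (q : entry m) g t :
  move1 q (upd g q t) = upd g q (twice_below q g - t).
Proof.
rewrite /move1 upd_upd [upd g q t q]/upd eqxx; congr (upd _ _ (_ - _)).
rewrite /twice_below; case: ifP => // qm; rewrite /upd; case: eqP => // e.
by have := below_row qm; rewrite e => /n_Sn.
Qed.

Lemma upd_unitri m (g : entry m -> int) (p : entry m) t :
  unitri g -> (p.1.2 < p.2)%N -> unitri (upd g p t).
Proof.
move=> gt lt q; rewrite /upd; case: eqP => [->|_]; last exact: gt.
by split=> h; move: lt; [rewrite ltnNge (ltnW h)|rewrite h ltnn].
Qed.

(** The Folner estimate. Above the diagonal a segment of half-length [L] is reflected and shifted by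
    at most [2 * L / N]; on the diagonal 1 and -1 are exchanged; below it 0 is fixed. *)
Lemma avg1_move (R : realType) m N (B : R) (u : (entry m -> int) -> R) q g :
  (0 < N)%N -> (forall g, unitri g -> `|u g| <= B) ->
  (forall p, g p \in ranges N p) ->
  `|avg1 (ranges N) q (u \o move1 q) g - avg1 (ranges N) q u g| <= 2 * B / N%:R.
Proof.
move=> N0 uB gr; have gt := ranges_unitri gr.
have B0 : 0 <= B by apply: le_trans (uB g gt).
have k0 : 0 <= 2 * B / N%:R by rewrite divr_ge0 // mulr_ge0.
rewrite /avg1 -mulrBr; under eq_bigr do rewrite /= move1_upd.
case: (ltnP q.1.2 q.2) => [lt|le]; last first.
  rewrite twice_below0 // /ranges ltnNge le /=.
  case: ifP => _; rewrite !big_cons !big_nil /= sub0r ?opprK ?oppr0.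
    by rewrite !addr0 [X in X - _]addrC subrr mulr0 normr0.
  by rewrite subrr mulr0 normr0.
have := twice_below_bound N0 gr lt; rewrite /ranges lt size_segment.
set L := (N ^ (q.2 - q.1.2))%N; set s := twice_below q g => sL.
have := @segment_shift _ (fun t => u (upd g q t)) L B s
  (fun t => uB _ (upd_unitri t gt lt)).
rewrite normrM normfV normr_nat ler_pdivrMl ?ltr0n // => /le_trans; apply.
have sL' : `|s|%:~R <= 2 * (N ^ (q.2 - q.1.2).-1)%:R :> R.
  by rewrite -natrM pmulrn ler_int.
apply: (@le_trans _ _ (2 * B * (2 * (N ^ (q.2 - q.1.2).-1)%:R))).
  by rewrite ler_wpM2l // mulr_ge0.
have -> : 2 * (N ^ (q.2 - q.1.2).-1)%:R = (2 * L)%:R / N%:R :> R.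
  rewrite /L -{2}(@prednK (q.2 - q.1.2)) ?subn_gt0 // expnS !natrM.
  by field; rewrite pnatr_eq0 -lt0n.
rewrite mulrA mulrAC [leRHS]mulrC ler_wpM2l // ler_nat; lia.
Qed.

Lemma avg_move1 (R : realType) m N (B : R) (u : (entry m -> int) -> R) ps q g0 :
  (0 < N)%N -> (forall g, unitri g -> `|u g| <= B) -> q \in ps ->
  (forall p, g0 p \in ranges N p) ->
  `|avg (ranges N) ps (u \o move1 q) g0 - avg (ranges N) ps u g0| <= 2 * B / N%:R.
Proof.
move=> N0 uB qps g0r; rewrite !(avg_rem _ _ qps) -mulN1r.
set w := avg1 _ q (u \o _); set w' := avg1 _ q u.
have -> : avg (ranges N) (rem q ps) w g0 + -1 * avg (ranges N) (rem q ps) w' g0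
    = avg (ranges N) (rem q ps) (fun g => w g + -1 * w' g) g0.
  by rewrite avgD (avgZ _ _ (-1) w').
by apply: avg_norm => // g gr; rewrite mulN1r; exact: avg1_move.
Qed.

(** Within one flag [rows i] meets a single row, so the entry below [q] is not in [qs] and
    simultaneous changes agree with successive ones. *)
Lemma rowmove_cons m i (q : entry m) qs g :
  {subset q :: qs <= rows i} -> q \notin qs ->
  rowmove (q :: qs) g = move1 q (rowmove qs g).
Proof.
move=> sub qqs; apply/funext => p; rewrite /move1 /upd /rowmove inE.
case: (eqVneq p q) => [->|//] /=; rewrite (negbTE qqs).
congr (_ - _); rewrite /twice_below; case: ifP => // qm.
case: ifP => // bqs; have := sub (below q); rewrite inE bqs orbT => /(_ isT).
have := sub q (mem_head _ _); rewrite !mem_filter below_row //.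
case/andP => /andP[_ /eqP /= <-] _; case/andP => /andP[_].
by rewrite eqn_leq ltnn.
Qed.

Lemma avg_rowmove (R : realType) m N (B : R) (u : (entry m -> int) -> R) ps i qs g0 :
  (0 < N)%N -> (forall g, unitri g -> `|u g| <= B) -> uniq qs ->
  {subset qs <= rows i} -> {subset qs <= ps} ->
  (forall p, g0 p \in ranges N p) ->
  `|avg (ranges N) ps (u \o rowmove qs) g0 - avg (ranges N) ps u g0|
    <= (size qs)%:R * (2 * B / N%:R).
Proof.
move=> N0 + + + + g0r; elim: qs u => [|q qs IH] u uB /=.
  by rewrite (_ : u \o rowmove [::] = u) // subrr normr0 mul0r.
move=> /andP[qqs uqs] sub subp.
have -> : u \o rowmove (q :: qs) = (u \o move1 q) \o rowmove qs.
  by apply/funext => g /=; rewrite (rowmove_cons _ sub).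
have uB' g : unitri g -> `|(u \o move1 q) g| <= B.
  by move=> gt; apply: uB; exact: move1_unitri.
have sub1 : {subset qs <= rows i} by move=> p pq; apply: sub; rewrite inE pq orbT.
have sub2 : {subset qs <= ps} by move=> p pq; apply: subp; rewrite inE pq orbT.
rewrite -natr1 mulrDl mul1r -(subrKA (avg (ranges N) ps (u \o move1 q) g0)).
apply: le_trans (ler_normD _ _) _; apply: lerD; first exact: IH.
by apply: avg_move1 => //; rewrite subp // mem_head.
Qed.

(** The move changes the average little but also negates it, so twice the average is small. *)
Lemma avg_odd_small (R : realType) m N (B : R) (u : (entry m -> int) -> R) i g0 :
  (0 < N)%N -> (forall g, unitri g -> `|u g| <= B) ->
  (forall g, unitri g -> u (rowmove (rows i) g) = - u g) ->
  (forall p, g0 p \in ranges N p) ->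
  `|avg (ranges N) (enum {: entry m}) u g0| <= #|{: entry m}|%:R * B / N%:R.
Proof.
move=> N0 uB uodd g0r; have gt := ranges_unitri g0r.
have B0 : 0 <= B by apply: le_trans (uB _ gt).
have := @avg_rowmove _ _ _ _ u (enum {: entry m}) i (rows i) g0 N0 uB
  (filter_uniq _ (enum_uniq _)) (fun p pr => pr)
  (fun p _ => eq_trans (mem_enum _ p) isT) g0r.
have -> : avg (ranges N) (enum {: entry m}) (u \o rowmove (rows i)) g0
    = - avg (ranges N) (enum {: entry m}) u g0.
  apply/eqP; rewrite -addr_eq0 -[X in _ + X]/((fun g => avg _ _ u g) g0).
  rewrite -[X in X == _]/((fun g => _ g + _ g) g0) -avgD; apply/eqP.
  apply: avg_eq => // g gr; rewrite /= uodd ?addNr //; exact: ranges_unitri gr.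
rewrite -opprD normrN -mulr2n normrMn => h.
rewrite -(ler_pMn2r (isT : (0 < 2)%N)); apply: le_trans h _.
have -> : #|{: entry m}|%:R * B / N%:R *+ 2 = #|{: entry m}|%:R * (2 * B / N%:R).
  by rewrite -mulr_natl; ring.
rewrite ler_wpM2r ?divr_ge0 ?mulr_ge0 // ler_nat cardE size_filter.
exact: count_size.
Qed.

(** * The cocycle on generic tuples *)

Lemma continuous_det (R : realType) (n : nat) :
  continuous (fun M : 'M[R]_n => \det M).
Proof.
have csum (J : Type) (s : seq J) (F : J -> 'M[R]_n -> R) :
    (forall i, continuous (F i)) -> continuous (fun M => \sum_(i <- s) F i M).
  move=> cF; elim: s => [|i s IH].
    have -> : (fun M => \sum_(j <- [::]) F j M) = fun=> 0.
      by apply/funext => M; rewrite big_nil.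
    exact: cst_continuous.
  have -> : (fun M => \sum_(j <- i :: s) F j M) = fun M => F i M + \sum_(j <- s) F j M.
    by apply/funext => M; rewrite big_cons.
  by move=> M; apply: (@continuousD _ _ _ (F i)); [exact: cF|exact: IH].
have cprod (J : Type) (s : seq J) (F : J -> 'M[R]_n -> R) :
    (forall i, continuous (F i)) -> continuous (fun M => \prod_(i <- s) F i M).
  move=> cF; elim: s => [|i s IH].
    have -> : (fun M => \prod_(j <- [::]) F j M) = fun=> 1.
      by apply/funext => M; rewrite big_nil.
    exact: cst_continuous.
  have -> : (fun M => \prod_(j <- i :: s) F j M) = fun M => F i M * \prod_(j <- s) F j M.
    by apply/funext => M; rewrite big_cons.
  by move=> M; apply: (@continuousM _ _ (F i)); [exact: cF|exact: IH].
apply: csum => s M; apply: (@continuousM _ _ (fun=> _)); first exact: cst_continuous.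

exact: (@cprod _ (index_enum _) (fun i M => M i (s i)) (fun i => @coord_continuous R n n i (s i))).
Qed.

Lemma sg_det_near (R : realType) (n : nat) (M0 : 'M[R]_n) : \det M0 != 0 ->
  exists2 d : R, 0 < d & forall M : 'M[R]_n, (forall a b, `|M a b - M0 a b| < d) ->
    Num.sg (\det M) = Num.sg (\det M0).
Proof.
move=> D0; have Dp : 0 < `|\det M0| by rewrite normr_gt0.
have /cvgr_dist_lt/(_ _ Dp)/nbhs_ballP[d /= d0 H] := @continuous_det R n M0.
exists d => // M MM0; have {}H : `|\det M0 - \det M| < `|\det M0|.
  by apply: H; split => // a b; rewrite /ball /= distrC.
case: (ltgtP (\det M0) 0) D0 H => // s _ H.
  rewrite (ltr0_sg s) ltr0_sg //; move: H; rewrite (ltr0_norm s) ltr_norml; lra.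
rewrite (gtr0_sg s) gtr0_sg //; move: H; rewrite (gtr0_norm s) ltr_norml; lra.
Qed.

(** The first columns are independent, so the line of each new flag is outside the span of the
    previous ones: every bracket has d = 1 and appends a first column. *)
Lemma bracket_first (R : realType) (m : nat) (Ms : seq 'M[R]_m.+1) :
  size Ms = m.+1 ->
  \det (\matrix_(i < m.+1, b < m.+1) (nth 0 Ms i) b ord0) != 0 ->
  bracket Ms = [seq (col ord0 M)^T | M <- Ms].
Proof.
move=> sM; set D := \matrix_(i, b) _ => D0.
have Du : D \in unitmx by rewrite unitmxE unitfE.
suff H k : (k <= m.+1)%N ->
    bracket (take k Ms) = take k [seq (col ord0 M)^T | M <- Ms].
  by have := H _ (leqnn _); rewrite !take_oversize ?size_map ?sM.
elim: k => [|k IH] km; first by rewrite !take0.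
rewrite (take_nth 0) ?sM // (take_nth 0) ?size_map ?sM //.
rewrite /bracket foldl_rcons -/(bracket _) IH ?(ltnW km) //.
set W := take k _; rewrite (nth_map 0) ?sM // /bracket_step; congr rcons.
have sW : size W = k by rewrite size_take size_map sM km.
rewrite /flagvecs enum_ordSl /=; set v := (col ord0 _)^T.
suff -> : ~~ (v <= spanmx W)%MS by [].
pose k' : 'I_m.+1 := Ordinal km.
have vE : v = delta_mx 0 k' *m D.
  by rewrite -rowE; apply/rowP => b; rewrite !mxE.
pose Ik : 'M[R]_m.+1 := pid_mx k.
(* [Ik *m D] keeps the first [k] rows of the invertible [D], while [v] is the row of index [k]. *)
have WE : (spanmx W <= Ik *m D)%MS.
  apply/row_subP => i; have ik : (i < k)%N by rewrite -sW.
  have im : (i < m.+1)%N by exact: ltn_trans ik km.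
  have -> : row i (spanmx W) = row (Ordinal im) (Ik *m D).
    rewrite row_mul; have -> : row (Ordinal im) Ik = delta_mx 0 (Ordinal im) :> 'rV[R]_m.+1.
      by apply/rowP => b; rewrite !mxE /= ik andbT -val_eqE eq_sym.
    apply/rowP => b; rewrite -rowE !mxE nth_take // (nth_map 0) ?sM //.
    by rewrite !mxE.
  exact: row_sub.
apply/negP => vW; have := submx_trans vW WE; rewrite vE submxMfree; last first.
  by rewrite row_free_unit.
case/submxP => z /matrixP /(_ 0 k'); rewrite !mxE big1 => [/eqP|i _].
  by rewrite !eqxx oner_eq0.
by rewrite mxE; case: eqP => [->|]; rewrite ?ltnn ?andbF /= ?mulr0.
Qed.

(* The first column of a matrix spans the line of its flag. *)
Definition lines_mx (R : realType) m (x : pts R m.+1 m.+2) (i : 'I_m.+2) : 'M[R]_m.+1 :=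
  \matrix_(a, b) x (lift i a) b ord0.

Lemma lines_mx_scale (R : realType) m (x y : pts R m.+1 m.+2) (eps : 'I_m.+2 -> R) i :
  (forall l b, y l b ord0 = eps l * x l b ord0) ->
  lines_mx y i = diag_mx (\row_a eps (lift i a)) *m lines_mx x i.
Proof. by move=> yx; apply/matrixP => a b; rewrite mul_diag_mx [LHS]mxE yx !mxE. Qed.

Lemma Ecoc_generic (R : realType) m (x : pts R m.+1 m.+2) :
  (forall i, \det (lines_mx x i) != 0) ->
  Ecoc x = \prod_(i < m.+2) Num.sg (\det (lines_mx x i)).
Proof.
move=> D0; apply: eq_bigr => i _.
have mE : \matrix_(a < m.+1, b < m.+1)
    (nth 0 [seq x (lift i j) | j <- enum 'I_m.+1] a) b ord0 = lines_mx x i.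
  by apply/matrixP => a b; rewrite !mxE (nth_map ord0) ?size_enum_ord // nth_ord_enum.
rewrite bracket_first ?mE ?size_map ?size_enum_ord //.
  congr (Num.sg (\det _)); rewrite -mE; apply/matrixP => a b; rewrite mxE [RHS]mxE.
  by rewrite (nth_map (0 : 'M[R]_m.+1)) ?mxE // size_map size_enum_ord.
by rewrite -enumT size_enum_ord.
Qed.

(** Each sign occurs in the m+1 faces that contain its index, an even number. This is where the
    parity of the dimension enters. *)
Lemma prod_lift_sign (R : comNzRingType) m (eps : 'I_m.+2 -> R) :
  odd m -> (forall l, eps l * eps l = 1) ->
  \prod_(i < m.+2) \prod_(a < m.+1) eps (lift i a) = 1.
Proof.
move=> om e2; pose P := \prod_l eps l.
have liftE (i : 'I_m.+2) : \prod_(a < m.+1) eps (lift i a) = eps i * P.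
  by rewrite /P (bigD1_ord i) //= mulrA e2 mul1r.
have P2 : P * P = 1 by rewrite /P -big_split big1 // => l _; exact: e2.
under eq_bigr do rewrite liftE; rewrite big_split /= -/P prodr_const card_ord.
by rewrite -exprS -(@even_halfK m.+3) /= ?om // -mul2n exprM expr2 P2 expr1n.
Qed.

Lemma prod_lines_sign (R : realType) m (x y : pts R m.+1 m.+2) (eps : 'I_m.+2 -> R) :
  odd m -> (forall l, eps l * eps l = 1) ->
  (forall l b, y l b ord0 = eps l * x l b ord0) ->
  \prod_(i < m.+2) Num.sg (\det (lines_mx y i))
    = \prod_(i < m.+2) Num.sg (\det (lines_mx x i)).
Proof.
move=> om e2 yx.
have e1 l : Num.sg (eps l) = eps l.
  have : (eps l - 1) * (eps l + 1) == 0 by rewrite -subr_sqr expr1n expr2 e2 subrr.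
  rewrite mulf_eq0 subr_eq0 addr_eq0 => /orP[]/eqP ->; first exact: sgr1.
  by rewrite sgrN sgr1.
transitivity (\prod_(i < m.+2) ((\prod_(a < m.+1) eps (lift i a))
    * Num.sg (\det (lines_mx x i)))).
  apply: eq_bigr => i _.
  rewrite (lines_mx_scale _ yx) det_mulmx det_diag sgrM; congr (_ * _).
  have sgP (J : Type) (s : seq J) (F : J -> R) :
      Num.sg (\prod_(j <- s) F j) = \prod_(j <- s) Num.sg (F j).
    by apply: (big_morph Num.sg (@sgrM R)); exact: sgr1.
  by rewrite sgP; apply: eq_bigr => a _; rewrite mxE e1.
by rewrite big_split /= prod_lift_sign // mul1r.
Qed.

(** A lift changes the first columns by signs only, so all lifts give the same value of E. *)
Lemma Acoc_generic (R : realType) m (x : pts R m.+1 m.+2) :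
  odd m -> (forall i, \det (lines_mx x i) != 0) ->
  Acoc x = \prod_(i < m.+2) Num.sg (\det (lines_mx x i)).
Proof.
move=> om D0; rewrite /Acoc.
under eq_bigr => s _.
  pose y := fun i => x i *m diag_mx (\row_j (if s (i, j) then -1 else 1)).
  pose eps i : R := if s (i, ord0) then -1 else 1.
  have e2 l : eps l * eps l = 1 by rewrite /eps; case: ifP; rewrite ?mulrNN mulr1.
  have yx l b : y l b ord0 = eps l * x l b ord0.
    by rewrite /y mul_mx_diag !mxE mulrC.
  have Dy i : \det (lines_mx y i) != 0.
    rewrite (lines_mx_scale _ yx) det_mulmx mulf_neq0 // det_diag; apply/prodf_neq0 => a _.
    by rewrite mxE /eps; case: ifP; rewrite ?oppr_eq0 oner_eq0.
  rewrite (Ecoc_generic Dy) (prod_lines_sign om e2 yx).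
  over.
rewrite sumr_const card_ffun card_bool card_prod !card_ord.
rewrite -[X in _ * X = _]mulr_natr natrX mulrCA [(m.+2 * _)%N]mulnC.
by rewrite mulVf ?mulr1 // expf_neq0 // pnatr_eq0.
Qed.

(** Used with the diagonal entries of an integer family as signs: they move the first columns away
    from e_l to -e_l. *)
Lemma Acoc_scaled (R : realType) m (x y : pts R m.+1 m.+2) (eps : 'I_m.+2 -> R) :
  odd m -> (forall l, eps l * eps l = 1) ->
  (forall l b, y l b ord0 = eps l * x l b ord0) ->
  (forall i, \det (lines_mx x i) != 0) ->
  Acoc y = \prod_(i < m.+2) Num.sg (\det (lines_mx x i)).
Proof.
move=> om e2 yx D0; rewrite -(prod_lines_sign om e2 yx); apply: Acoc_generic => // i.
rewrite (lines_mx_scale _ yx) det_mulmx mulf_neq0 // det_diag.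
apply/prodf_neq0 => a _; rewrite mxE; apply/eqP => e0.
by have := e2 (lift i a); rewrite e0 mul0r => /eqP; rewrite eq_sym oner_eq0.
Qed.

Lemma Acoc_le1 (R : realType) n (x : pts R n n.+1) : `|Acoc x| <= 1.
Proof.
rewrite /Acoc normrM normfV normrX normr_nat ler_pdivrMl ?exprn_gt0 // mulr1.
apply: le_trans (ler_norm_sum _ _ _) _.
apply: (@le_trans _ _ (\sum_(s : {ffun 'I_n.+1 * 'I_n -> bool}) 1)).
  apply: ler_sum => s _; rewrite /Ecoc normr_prod.
  apply: prodr_ile1 => i _; rewrite normr_ge0 normr_sg.
  by rewrite /= lern1; case: (_ != _).
by rewrite sumr_const card_ffun card_bool card_prod !card_ord mulnC natrX.
Qed.

(** * The flags F_j and the reflections g_i *)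

(** The vectors e_l of the overview with n = m+1. Their sum is 0, so cyclic shifts of the indices
    are induced by linear maps. *)
Definition simplex_vec (R : realType) m (l : 'I_m.+2) : 'cV[R]_m.+1 :=
  \col_a (if (l < m.+1)%N then (a == l :> nat)%:R else -1).

Definition vec_map (R : realType) m (f : 'I_m.+2 -> 'cV[R]_m.+1) : 'M[R]_m.+1 :=
  \matrix_(a, b) f (widen_ord (leqnSn _) b) a 0.

Lemma simplex_vec_widen (R : realType) m (b : 'I_m.+1) :
  simplex_vec R (widen_ord (leqnSn _) b) = delta_mx b 0.
Proof. by apply/colP => a; rewrite !mxE /= ltn_ord andbT. Qed.

Lemma simplex_vec_max (R : realType) m :
  simplex_vec R (ord_max : 'I_m.+2)
    = - \sum_(b < m.+1) simplex_vec R (widen_ord (leqnSn _) b).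
Proof.
apply/colP => a; rewrite !mxE ltnn summxE (bigD1 a) //= big1 => [|b ba].
  by rewrite simplex_vec_widen mxE !eqxx addr0.
by rewrite simplex_vec_widen mxE eq_sym (negbTE ba).
Qed.

Lemma sum_simplex_vec (R : realType) m : \sum_(l < m.+2) simplex_vec R l = 0.
Proof. by rewrite big_ord_recr /= simplex_vec_max subrr. Qed.

(** The last vector is minus the sum of the others, and the hypothesis says the same of the
    images. *)
Lemma vec_mapP (R : realType) m (f : 'I_m.+2 -> 'cV[R]_m.+1) l :
  \sum_l f l = 0 -> vec_map f *m simplex_vec R l = f l.
Proof.
move=> f0.
have fw b : vec_map f *m simplex_vec R (widen_ord (leqnSn _) b) = f (widen_ord (leqnSn _) b).
  by rewrite simplex_vec_widen -colE; apply/colP => a; rewrite !mxE.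
have [lm|lm] := ltnP l m.+1.
  by rewrite (_ : l = widen_ord (leqnSn _) (Ordinal lm)) //; apply: val_inj.
have -> : l = ord_max by apply/val_inj/eqP; rewrite eqn_leq lm /= -ltnS ltn_ord.
rewrite simplex_vec_max mulmxN mulmx_sumr; under eq_bigr do rewrite fw.
by apply/eqP; rewrite eq_sym -addr_eq0 addrC; move: f0; rewrite big_ord_recr => /eqP.
Qed.

Lemma simplex_vec_inj (R : realType) m (A B : 'M[R]_m.+1) :
  (forall b, A *m simplex_vec R (widen_ord (leqnSn _) b)
     = B *m simplex_vec R (widen_ord (leqnSn _) b)) -> A = B.
Proof.
move=> AB; apply/matrixP => a b; have := AB b.
by rewrite simplex_vec_widen -!colE => /colP /(_ a); rewrite !mxE.
Qed.

(** Represents the flag F_j; [j + l] is addition modulo m+2. *)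
Definition rot_mx (R : realType) m (j : 'I_m.+2) : 'M[R]_m.+1 :=
  vec_map (fun l => simplex_vec R (j + l)).

Lemma rot_mxP (R : realType) m (j l : 'I_m.+2) :
  rot_mx R j *m simplex_vec R l = simplex_vec R (j + l).
Proof.
apply: (@vec_mapP _ _ (fun l => simplex_vec R (j + l))).
by rewrite -[RHS](sum_simplex_vec R m) [RHS](reindex_inj (addrI j)).
Qed.

Lemma rot_mx_unit (R : realType) m (j : 'I_m.+2) : rot_mx R j \in unitmx.
Proof.
suff /mulmx1_unit[] : rot_mx R j *m rot_mx R (- j) = 1%:M by [].
by apply: simplex_vec_inj => l; rewrite -mulmxA !rot_mxP addNKr mul1mx.
Qed.

Lemma rot_mx_le1 (R : realType) m (j : 'I_m.+2) a b : `|rot_mx R j a b| <= 1.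
Proof.
rewrite !mxE; case: ifP => _; last by rewrite normrN1.
by rewrite normr_nat lern1; case: (_ == _).
Qed.

(** The vectors other than e_i are the columns of the invertible [rot_mx (i + 1)]. *)
Lemma simplex_vec_general (R : realType) m (i : 'I_m.+2) :
  \det (\matrix_(a < m.+1, b < m.+1) simplex_vec R (lift i a) b 0) != 0.
Proof.
set M := \matrix_(a, b) _; rewrite -unitfE -unitmxE -row_full_unit.
have sub : ((rot_mx R (i + 1)%R)^T <= M)%MS.
  apply/row_subP => b; pose l := i + 1 + widen_ord (leqnSn _) b.
  have il : i != l.
    rewrite /l -addrA -[X in X != _]addr0 (inj_eq (addrI i)) -val_eqE /=.
    rewrite (modn_small (isT : 1 < m.+2)%N) add1n modn_small //; exact: (ltn_ord b).
  have [a la _] := unlift_some il.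
  have -> : row b (rot_mx R (i + 1)%R)^T = row (a : 'I_m.+1) M; last exact: row_sub.
  by apply/rowP => c; rewrite !mxE -la.
rewrite -sub1mx; apply: submx_trans sub; rewrite sub1mx row_full_unit unitmx_tr.
exact: rot_mx_unit.
Qed.

(** The term [2 *: e_(i-1)] in the image of e_i keeps the sum of all images equal to 0. *)
Definition refl_vec (R : realType) m (i l : 'I_m.+2) : 'cV[R]_m.+1 :=
  if l + 1 == i then - simplex_vec R l
  else if l == i then simplex_vec R l + 2 *: simplex_vec R (l - 1)
  else simplex_vec R l.

Definition refl_mx (R : realType) m (i : 'I_m.+2) : 'M[R]_m.+1 := vec_map (refl_vec R i).

Lemma ord_succ_neq m (i : 'I_m.+2) : (i + 1 == i) = false.
Proof. by rewrite -[X in _ == X]addr0 (inj_eq (addrI i)) oner_eq0. Qed.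

Lemma refl_mxP (R : realType) m (i l : 'I_m.+2) :
  refl_mx R i *m simplex_vec R l = refl_vec R i l.
Proof.
apply: vec_mapP.
have i1 : i - 1 != i by rewrite -subr_eq0 addrAC subrr sub0r oppr_eq0 oner_eq0.
rewrite -[RHS](sum_simplex_vec R m) !(bigD1 i (P := xpredT)) //=.
rewrite !(bigD1 (i - 1) (P := fun j => j != i)) //=.
rewrite {1 2}/refl_vec ord_succ_neq eqxx subrK eqxx scaler_nat mulr2n -!addrA addNKr.
do 2 congr (_ + _); apply: eq_bigr => j /andP[ji ji1].
by rewrite /refl_vec (negbTE ji) eq_sym -subr_eq eq_sym (negbTE ji1).
Qed.

(** The matrix of g_i in the basis of F_j for [k = i - j]. It is upper triangular, so g_i stabilises
    F_j. *)
Definition row_mx_op (R : realType) m (k : nat) : 'M[R]_m.+1 :=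
  \matrix_(a, b) ((a == b)%:R * (if a.+1 == k then -1 else 1)
    + ((a.+1 == b) && (b == k :> nat))%:R * 2).

Lemma row_mx_op_col (R : realType) m k (b : 'I_m.+1) : (0 < k)%N ->
  row_mx_op R m k *m simplex_vec R (widen_ord (leqnSn _) b)
  = (if b.+1 == k then -1 else 1) *: simplex_vec R (widen_ord (leqnSn _) b)
    + (if b == k :> nat then 2 else 0)
        *: simplex_vec R (widen_ord (leqnSn _) (inord b.-1 : 'I_m.+1)).
Proof.
move=> k0; rewrite !simplex_vec_widen -colE; apply/colP => a; rewrite !mxE !andbT.
congr (_ + _); first by case: (eqVneq a b) => [->|_]; rewrite ?mul1r ?mulr1 ?mul0r ?mulr0.
case: (eqVneq (b : nat) k) => [bk|_]; last by rewrite andbF !mul0r.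
rewrite andbT mulrC -val_eqE /= inordK; last by apply: leq_ltn_trans (leq_pred _) (ltn_ord b).
have b0 : (0 < b)%N by rewrite bk.
by rewrite -{1}(prednK b0) eqSS.
Qed.

Lemma row_mx_op_mul (R : realType) m k (X : 'M[R]_m.+1) (a c : 'I_m.+1) :
  (row_mx_op R m k *m X) a c =
    if a.+1 == k then (if (a < m)%N then 2 * X (inord a.+1) c else 0) - X a c
    else X a c.
Proof.
rewrite mxE; under eq_bigr do rewrite mxE mulrDl.
rewrite big_split /= (bigD1 a) //= big1 => [|b ba]; last first.
  by rewrite eq_sym (negbTE ba) !mul0r.
rewrite eqxx mul1r addr0.
have -> : \sum_(b < m.+1) ((a.+1 == b) && (b == k :> nat))%:R * 2 * X b c
    = if (a.+1 == k) && (a < m)%N then 2 * X (inord a.+1) c else 0.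
  case: ifP => [/andP[ak am]|h].
    rewrite (bigD1 (inord a.+1)) //= inordK // eqxx ak mul1r big1 ?addr0 // => b ba.
    case: eqP => [e|]; rewrite ?mul0r //=.
    by case/eqP: ba; apply: val_inj; rewrite /= inordK.
  rewrite big1 // => b _; case: eqP => [e|]; rewrite ?mul0r //=.
  have am : (a < m)%N by rewrite -ltnS e ltn_ord.
  by rewrite -e; move: h; rewrite am andbT => ->; rewrite !mul0r.
case: (a.+1 == k) => /=; last by rewrite mul1r addr0.
by rewrite mulN1r addrC.
Qed.

Lemma det_row_mx_op (R : realType) m k : (0 < k <= m.+1)%N -> \det (row_mx_op R m k) = -1.
Proof.
case/andP => k0 km; rewrite -det_tr det_trig; last first.
  apply/is_trig_mxP => a b ab; rewrite !mxE -val_eqE gtn_eqF // mul0r add0r.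
  by rewrite (gtn_eqF (leqW ab)) mul0r.
have kk : (k.-1 < m.+1)%N by rewrite prednK.
have diag (a : 'I_m.+1) : (row_mx_op R m k)^T a a = if a.+1 == k then -1 else 1.
  by rewrite !mxE eqxx mul1r (gtn_eqF (ltnSn a)) mul0r addr0.
rewrite (bigD1 (Ordinal kk)) //= big1 => [|a ak]; rewrite diag.
  by rewrite mulr1 /= prednK ?eqxx.
by case: eqP => // e; case/eqP: ak; apply: val_inj; rewrite /= -e.
Qed.

(** For [j <> i] the basis of F_j contains e_(i-1), preceding e_i whenever e_i occurs too; F_i is
    the one flag whose basis omits e_(i-1). *)
Lemma refl_rot (R : realType) m (i j : 'I_m.+2) : j != i ->
  refl_mx R i *m rot_mx R j = rot_mx R j *m row_mx_op R m (i - j)%R.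
Proof.
move=> ji; set k := (i - j)%R.
have k0 : (0 < k)%N.
  by rewrite lt0n -[0%N]/(val (0 : 'I_m.+2)) val_eqE subr_eq0 eq_sym.
apply: simplex_vec_inj => b; rewrite -!mulmxA rot_mxP refl_mxP row_mx_op_col //.
set w := widen_ord (leqnSn m.+1).
rewrite mulmxDr -!scalemxAr !rot_mxP /refl_vec.
have e1 : (j + w b + 1 == i) = (b.+1 == k).
  rewrite -addrA eq_sym addrC -subr_eq -/k eq_sym -(val_eqE _ k) /= (modn_small (isT : 1 < m.+2)%N).
  by rewrite addn1 (modn_small (ltn_ord b : b.+1 < m.+2)%N).
have e2 : (j + w b == i) = (b == k :> nat).
  by rewrite eq_sym addrC -subr_eq -/k eq_sym -val_eqE.
rewrite e1 e2; case: eqP => [bk|_].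
  by rewrite -bk ltn_eqF // scaleN1r scale0r addr0.
case: eqP => [bk|_]; last by rewrite scale1r scale0r addr0.
have b0 : (0 < b)%N by rewrite bk.
rewrite scale1r; congr (_ + _ *: simplex_vec R _); rewrite -addrA; congr (_ + _).
apply/eqP; rewrite subr_eq -val_eqE /= (modn_small (isT : 1 < m.+2)%N) addn1.
rewrite inordK; last by rewrite prednK // ltnW.
by rewrite prednK // modn_small // ltnW // ltnS.
Qed.

(** In the basis of F_(i+1) the matrix becomes triangular. *)
Lemma det_refl_mx (R : realType) m (i : 'I_m.+2) : \det (refl_mx R i) = -1.
Proof.
have ji : i + 1 != i by rewrite ord_succ_neq.
have := congr1 determinant (refl_rot R ji); rewrite !det_mulmx mulrC.
have /mulfI h : \det (rot_mx R (i + 1)) != 0 by rewrite -unitfE -unitmxE rot_mx_unit.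
move/h ->; apply: det_row_mx_op; apply/andP; split; last exact: (ltn_ord (i - (i + 1))).
by rewrite lt0n -[0%N]/(val (0 : 'I_m.+2)) val_eqE subr_eq0 eq_sym.
Qed.

(** * Configurations close to the special flags *)

Definition fam_mx (R : realType) m (g : entry m -> int) (j : 'I_m.+2) : 'M[R]_m.+1 :=
  \matrix_(a, b) (g (j, a, b))%:~R.

Lemma fam_mx_rowmove (R : realType) m (g : entry m -> int) (i j : 'I_m.+2) : j != i ->
  fam_mx R (rowmove (rows i) g) j = row_mx_op R m (i - j)%R *m fam_mx R g j.
Proof.
move=> ji; apply/matrixP => a b; rewrite row_mx_op_mul !mxE /rowmove mem_filter mem_enum.
rewrite /= ji /= andbT; case: ifP => // _.
by rewrite /twice_below /=; case: ifP => _; rewrite rmorphB //= rmorphM.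
Qed.

Lemma fam_mx_unit (R : realType) m (g : entry m -> int) j :
  unitri g -> fam_mx R g j \in unitmx.
Proof.
move=> gt; rewrite -unitmx_tr unitmxE unitfE det_trig; last first.
  by apply/is_trig_mxP => a b ab; rewrite !mxE (gt (j, b, a)).1.
apply/prodf_neq0 => a _; rewrite !mxE intr_eq0.
by case: ((gt (j, a, a)).2 erefl) => ->.
Qed.

(** For [y j] near the identity the j-th flag is near F_j, because the triangular factor stabilises
    the standard flag. *)
Definition config (R : realType) m (g : entry m -> int) (y : pts R m.+1 m.+2) :
  pts R m.+1 m.+2 := fun j => rot_mx R j *m fam_mx R g j *m y j.

(** On the face omitting [i] the row move is thus the action of one matrix on all flags, to which
    the equivariance of a cochain applies. *)
Lemma config_refl (R : realType) m (g : entry m -> int) (y : pts R m.+1 m.+2) i j :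
  j != i -> config (rowmove (rows i) g) y j = refl_mx R i *m config g y j.
Proof. by move=> ji; rewrite /config fam_mx_rowmove // !mulmxA refl_rot. Qed.

Lemma config_GLt (R : realType) m (g : entry m -> int) (y : pts R m.+1 m.+2) :
  unitri g -> GLt y -> GLt (config g y).
Proof. by move=> gt yu j; rewrite !unitmx_mul rot_mx_unit fam_mx_unit // yu. Qed.

Lemma rot_fam_first (R : realType) m (g : entry m -> int) j b : unitri g ->
  (rot_mx R j *m fam_mx R g j) b ord0 = (g (j, ord0, ord0))%:~R * simplex_vec R j b 0.
Proof.
move=> gt; rewrite mxE (bigD1 ord0) //= big1 => [|c c0]; last first.
  by rewrite [fam_mx _ _ _ _ _]mxE (gt (j, c, ord0)).1 ?mulr0 // lt0n.
rewrite addr0 mulrC [fam_mx _ _ _ _ _]mxE; congr (_ * _).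
rewrite -[in RHS](addr0 j) -rot_mxP.
have -> : (0 : 'I_m.+2) = widen_ord (leqnSn _) ord0 by apply: val_inj.
by rewrite simplex_vec_widen -colE [RHS]mxE.
Qed.

(** * Null sets of tuples: faces and left multiplication *)

Definition face (R : realType) n k (i : 'I_k.+1) (x : pts R n k.+1) : pts R n k :=
  fun j => x (lift i j).

Definition coords (R : realType) n k (x : pts R n k) : 'I_k * 'I_n * 'I_n -> R :=
  fun p => x p.1.1 p.1.2 p.2.

Lemma uncoordsK (R : realType) n k (x : pts R n k) : uncoords (coords x) = x.
Proof. by apply/funext => i; apply/matrixP => a b; rewrite mxE. Qed.

Lemma tnull_face (R : realType) n k (i : 'I_k.+1) (S : set (pts R n.+1 k)) :
  tnull S -> tnull [set x | S (face i x)].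
Proof.
move=> nS; pose f (q : 'I_k * 'I_n.+1 * 'I_n.+1) := (lift i q.1.1, q.1.2, q.2).
have fI : injective f.
  move=> [[j a] b] [[j' a'] b'] /eqP; rewrite /f /= !xpair_eqE.
  by case/andP => /andP[/eqP/lift_inj -> /eqP ->] /eqP ->.
exact: lnull_sub (lnull_cylinder (i, ord0, ord0) fI nS).
Qed.

Lemma tnull_mul (R : realType) n k (j0 : 'I_k) (M : 'I_k -> 'M[R]_n.+1) (S : set (pts R n.+1 k)) :
  (forall j, M j \in unitmx) -> tnull S -> tnull [set x | S (fun j => M j *m x j)].
Proof.
move=> Mu nS.
(* [K] dominates the row sums of all the inverses, hence their Lipschitz constants for the sup
   norm. *)
pose K : R := \sum_j \sum_a \sum_c `|invmx (M j) a c| + 1.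
have K0 : 0 < K.
  rewrite ltr_wpDl // sumr_ge0 // => j _; rewrite sumr_ge0 // => a _.
  by rewrite sumr_ge0.
pose T (p : 'I_k * 'I_n.+1 * 'I_n.+1 -> R) := coords (fun j => M j *m uncoords p j).
apply: lnull_sub (@lnull_preimage _ _ (j0, ord0, ord0) T K _ K0 _ nS) => [p /=|x y c].
  by rewrite uncoordsK.
move=> H [[j a] b].
have c0 : 0 <= c by apply: le_trans (normr_ge0 _) (H (j, a, b)).
have pE (p : 'I_k * 'I_n.+1 * 'I_n.+1 -> R) :
    p (j, a, b) = \sum_d invmx (M j) a d * T p (j, d, b).
  have := congr1 (fun X : 'M[R]_n.+1 => X a b) (mulKmx (Mu j) (uncoords p j)).
  by rewrite [RHS]mxE => <-; rewrite [LHS]mxE.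
rewrite !pE -sumrB; apply: le_trans (ler_norm_sum _ _ _) _.
apply: (@le_trans _ _ (\sum_d `|invmx (M j) a d| * c)).
  by apply: ler_sum => d _; rewrite -mulrBr normrM ler_wpM2l.
rewrite -mulr_suml ler_wpM2r // /K.
pose r i a' := \sum_c `|invmx (M i) a' c|.
have r0 i a' : 0 <= r i a' by exact: sumr_ge0.
apply: (@le_trans _ _ (\sum_a' r j a')).
  by rewrite [leRHS](bigD1 a) //= lerDl sumr_ge0.
apply: (@le_trans _ _ (\sum_i \sum_a' r i a')); last by rewrite lerDl.
by rewrite [leRHS](bigD1 j) //= lerDl sumr_ge0 // => i _; rewrite sumr_ge0.
Qed.

Lemma ranges_bound (R : realType) m N : exists2 B : R, 0 <= B &
  forall g : entry m -> int, (forall p, g p \in ranges N p) ->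
    forall p, `|(g p)%:~R| <= B.
Proof.
exists (\sum_(p : entry m) \sum_(t <- ranges N p) `|t%:~R|).
  by apply: sumr_ge0 => p _; exact: sumr_ge0.
move=> g gr p; rewrite (bigD1 p) //= (big_rem _ (gr p)) /= -addrA lerDl.
by rewrite addr_ge0 ?sumr_ge0 // => q _; exact: sumr_ge0.
Qed.

(** For odd [m], the value of A on the flags F_0, ..., F_n. *)
Definition simplex_sign (R : realType) m : R :=
  \prod_(i < m.+2) Num.sg (\det (\matrix_(a < m.+1, b < m.+1) simplex_vec R (lift i a) b 0)).

Lemma simplex_sign_norm (R : realType) m : `|simplex_sign R m| = 1.
Proof.
by rewrite /simplex_sign normr_prod big1 // => i _; rewrite normr_sg simplex_vec_general.
Qed.

(** For fixed [N] the entries of [g] are bounded, so one [d] keeps the first columns near plus or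
    minus e_j for all [g], and the signs of the nonzero determinants do not change. *)
Lemma Acoc_config_near (R : realType) m N : odd m ->
  exists2 d : R, 0 < d & forall (g : entry m -> int) (y : pts R m.+1 m.+2),
    (forall p, g p \in ranges N p) ->
    (forall j a b, `|y j a b - (a == b)%:R| < d) ->
    Acoc (config g y) = simplex_sign R m.
Proof.
move=> om; have [B B0 HB] := ranges_bound R m N.
have /choice[e He] (i : 'I_m.+2) : exists d : R, 0 < d /\ forall M : 'M[R]_m.+1,
    (forall a b, `|M a b - simplex_vec R (lift i a) b 0| < d) ->
    Num.sg (\det M) = Num.sg (\det (\matrix_(a < m.+1, b < m.+1) simplex_vec R (lift i a) b 0)).
  have [d d0 H] := sg_det_near (simplex_vec_general R i).
  by exists d; split=> // M HM; apply: H => a b; rewrite mxE.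
pose eta := \big[Num.min/1]_i e i.
have eta0 : 0 < eta by apply: lt_bigmin => [|i _]; [exact: ltr01|exact: (He i).1].
have etae i : eta <= e i by exact: bigmin_le_cond.
(* Bounds the error propagation: m+1 terms with coefficients at most [m.+1 * B]; the summand 1 makes
   the final inequality strict. *)
pose c : R := m.+1%:R * (m.+1%:R * B) + 1.
have c0 : 0 < c by rewrite ltr_wpDl // !mulr_ge0.
exists (eta / c); first exact: divr_gt0.
move=> g y gr ynear; have gt := ranges_unitri gr.
pose eps l : R := (g (l, ord0, ord0))%:~R.
have e2 l : eps l * eps l = 1.
  by rewrite /eps; case: ((gt (l, ord0, ord0)).2 erefl) => ->; rewrite ?mulrNN mulr1.
(* Undoing the diagonal signs of [g] brings the first columns near e_l itself. *)
pose z : pts R m.+1 m.+2 := fun l => eps l *: config g y l.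
have znear l b : `|z l b ord0 - simplex_vec R l b 0| < eta.
  set X := rot_mx R l *m fam_mx R g l.
  have -> : z l b ord0 - simplex_vec R l b 0
      = eps l * \sum_d X b d * (y l d ord0 - (d == ord0)%:R).
    under eq_bigr do rewrite mulrBr.
    rewrite sumrB mulrBr; congr (_ - _); first by rewrite !mxE.
    rewrite (bigD1 ord0) //= big1 => [|d d0]; last by rewrite (negbTE d0) mulr0.
    by rewrite mulr1 addr0 rot_fam_first // mulrA e2 mul1r.
  have X1 d : `|X b d| <= m.+1%:R * B.
    rewrite [X _ _]mxE; apply: le_trans (ler_norm_sum _ _ _) _.
    apply: (@le_trans _ _ (\sum_(a < m.+1) B)).
      apply: ler_sum => a _; rewrite normrM -[leRHS]mul1r ler_pM ?rot_mx_le1 //.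
      by rewrite [fam_mx _ _ _ _ _]mxE HB.
    by rewrite sumr_const card_ord mulr_natl.
  have ->: `|eps l * \sum_d X b d * (y l d ord0 - (d == ord0)%:R)|
      = `|\sum_d X b d * (y l d ord0 - (d == ord0)%:R)|.
    rewrite normrM; suff -> : `|eps l| = 1 by rewrite mul1r.
    by rewrite /eps; case: ((gt (l, ord0, ord0)).2 erefl) => ->; rewrite ?normrN1 ?normr1.
  apply: le_lt_trans (ler_norm_sum _ _ _) _.
  apply: (@le_lt_trans _ _ (\sum_(d < m.+1) (m.+1%:R * B) * (eta / c))).
    by apply: ler_sum => d _; rewrite normrM ler_pM // ltW.
  rewrite sumr_const card_ord.
  have -> : m.+1%:R * B * (eta / c) *+ m.+1 = eta * (m.+1%:R * (m.+1%:R * B) / c).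
    by rewrite -[LHS]mulr_natl; ring.
  by rewrite gtr_pMr // ltr_pdivrMr // mul1r /c ltrDl.
have sz i : Num.sg (\det (lines_mx z i))
    = Num.sg (\det (\matrix_(a < m.+1, b < m.+1) simplex_vec R (lift i a) b 0)).
  apply: (He i).2 => a b; rewrite mxE; exact: lt_le_trans (znear _ _) (etae i).
rewrite (@Acoc_scaled _ _ z _ eps) //.
- by apply: eq_bigr => i _; exact: sz.
- by move=> l b; rewrite /z [in RHS]mxE mulrA e2 mul1r.
by move=> i; rewrite -sgr_eq0 sz sgr_eq0 simplex_vec_general.
Qed.

(* All null sets are avoided at once by a single [y], since there are only
   countably many integer families [g]. *)
Lemma generic_point (R : realType) m (S : set (pts R m.+1 m.+2)) (d : R) :
  0 < d -> tnull S ->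
  exists y : pts R m.+1 m.+2, (forall j a b, `|y j a b - (a == b)%:R| < d) /\
    forall g, unitri g -> ~ S (config g y).
Proof.
move=> d0 nS; apply: contrapT => no.
pose i0 : entry m := (ord0, ord0, ord0).
pose bad (g : {ffun entry m -> int}) := [set p | unitri g /\ S (config g (uncoords p))].
have nbad g : lnull (bad g).
  case: (pselect (unitri g)) => gt; last first.
    by apply: lnull_sub (lnull_set0 i0) => p [].
  apply: lnull_sub (tnull_mul ord0 (M := fun j => rot_mx R j *m fam_mx R g j) _ nS).
    by move=> p [].
  by move=> j; rewrite unitmx_mul rot_mx_unit fam_mx_unit.
(* If no good [y] existed, the null bad sets would cover this box around the identity; half-side
   [d / 2] gives the strict bound. *)
pose lo (p : entry m) : R := (p.1.2 == p.2)%:R - d / 2.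
pose hi (p : entry m) : R := (p.1.2 == p.2)%:R + d / 2.
apply: (@box_not_null _ _ lo hi) => [p|]; first by rewrite /lo /hi; lra.
apply: lnull_sub (lnull_bigcup_count i0 nbad) => p pb; apply: contrapT => np.
apply: no; exists (uncoords p); split=> [j a b|g gt Sg].
  by rewrite mxE ltr_norml; have := pb (j, a, b); rewrite /lo /hi /=; lra.
apply: np; exists (finfun g) => //; rewrite /bad /=.
by have -> : (finfun g : entry m -> int) = g by apply/funext => q; rewrite ffunE.
Qed.

(** * The lower bound for an arbitrary cochain *)

Lemma coboundaryE (R : realType) n k (h : pts R n k -> R) (x : pts R n k.+1) :
  coboundary h x = \sum_(i < k.+1) (-1) ^+ i * h (face i x).
Proof. by []. Qed.

Lemma tnull_setU (R : realType) n k (i0 : 'I_k) (S T : set (pts R n.+1 k)) :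
  tnull S -> tnull T -> tnull (S `|` T).
Proof. exact: (lnull_setU (i0, ord0, ord0)). Qed.

Lemma tnull_bigcup (R : realType) n k (i0 : 'I_k) (J : countType)
    (S : J -> set (pts R n.+1 k)) :
  (forall j, tnull (S j)) -> tnull (\bigcup_j S j).
Proof. by move=> nS; exact: (lnull_bigcup_count (i0, ord0, ord0) nS). Qed.

Lemma Acoc_coboundary_bound (R : realType) m (h : pts R m.+1 m.+1 -> R) (C : R) :
  odd m -> ess_bounded h -> eps_equivariant h ->
  tnull [set x | GLt x /\ C < `|Acoc x + coboundary h x|] -> 1 <= C.
Proof.
move=> om [B nB] eqv nC; pose k : R := m.+2%:R * (#|{: entry m}|%:R * `|B|).
suff key N : (0 < N)%N -> 1 <= C + k / N%:R.
  (* If [C < 1], this [N] makes [k / N] smaller than [1 - C]. *)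
  rewrite leNgt; apply/negP => C1; pose N := (Num.bound (k / (1 - C))).+1.
  have k0 : 0 <= k by rewrite !mulr_ge0.
  have := key N isT; rewrite leNgt => /negP; apply.
  rewrite -ltrBrDl ltr_pdivrMr // mulrC -ltr_pdivrMr ?subr_gt0 //.
  apply: lt_le_trans (archi_boundP _) _; first by rewrite divr_ge0 // subr_ge0 ltW.
  by rewrite ler_nat.
(* The order matters: the distance [d] depends on [N], and the point [y] on [d]. *)
move=> N0; have [d d0 Ad] := @Acoc_config_near R m N om.
have det1_neq0 : \det (1%:M : 'M[R]_m.+1) != 0 by rewrite det1 oner_neq0.
have [d' d'0 H1] := sg_det_near det1_neq0.
pose bnd i := [set x : pts R m.+1 m.+2 | GLt (face i x) /\ `|B| < `|h (face i x)|].
pose eqn i := [set x : pts R m.+1 m.+2 | GLt (face i x) /\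
  h (fun j => refl_mx R i *m face i x j) <> Num.sg (\det (refl_mx R i)) * h (face i x)].
have refl_unit (i : 'I_m.+2) : refl_mx R i \in unitmx.
  by rewrite unitmxE unitfE det_refl_mx oppr_eq0 oner_eq0.
(* Points to avoid: the cochain exceeds [C], [h] exceeds its bound on a face, or equivariance under
   g_i fails on the face omitting [i]. *)
have nbad : tnull ([set x | GLt x /\ C < `|Acoc x + coboundary h x|]
    `|` ((\bigcup_i bnd i) `|` (\bigcup_i eqn i))).
  apply: (tnull_setU (ord0 : 'I_m.+2)) => //; apply: (tnull_setU (ord0 : 'I_m.+2)).
    apply: (tnull_bigcup (ord0 : 'I_m.+2)) => i.
    apply: (@tnull_face _ _ _ i [set w | GLt w /\ `|B| < `|h w|]).
    apply: lnull_sub nB => p [pG pB]; split => //; exact: le_lt_trans (ler_norm B) pB.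
  apply: (tnull_bigcup (ord0 : 'I_m.+2)) => i.
  apply: (@tnull_face _ _ _ i [set w | GLt w /\
    h (fun j => refl_mx R i *m w j) <> Num.sg (\det (refl_mx R i)) * h w]).
  exact: (eqv _ (refl_unit i)).
have dd : 0 < Num.min d d' by rewrite lt_min d0.
have [y [ynear yS]] := generic_point dd nbad.
have yG : GLt y.
  move=> j; rewrite unitmxE unitfE -sgr_eq0 H1 ?det1 ?sgr1 ?oner_neq0 // => a b.
  by rewrite mxE; apply: lt_le_trans (ynear _ _ _) _; rewrite ge_min lexx orbT.
have {}Ad g : (forall p, g p \in ranges N p) -> Acoc (config g y) = simplex_sign R m.
  by move=> gr; apply: Ad => // j a b; apply: lt_le_trans (ynear _ _ _) _; rewrite ge_min lexx.
have cG g i : unitri g -> GLt (face i (config g y)).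
  by move=> gt j; exact: config_GLt.
have hC g : unitri g -> `|Acoc (config g y) + coboundary h (config g y)| <= C.
  move=> gt; rewrite leNgt; apply/negP => lt; apply: (yS g gt); left; split => //.
  exact: config_GLt.
pose u i g := h (face i (config g y)).
have uB i g : unitri g -> `|u i g| <= `|B|.
  move=> gt; rewrite leNgt; apply/negP => lt; apply: (yS g gt); right; left.
  by exists i => //; split => //; exact: cG.
have uodd i g : unitri g -> u i (rowmove (rows i) g) = - u i g.
  move=> gt; transitivity (h (fun j => refl_mx R i *m face i (config g y) j)).
    by congr h; apply/funext => j; rewrite /face config_refl // eq_sym neq_lift.
  apply: contrapT => ne; apply: (yS g gt); right; right; exists i => //; split.
    exact: cG.
  by rewrite det_refl_mx sgrN sgr1 mulN1r.
(* Identity matrices as base family; every entry is then averaged. *)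
pose g0 (p : entry m) : int := (p.1.2 == p.2)%:R.
have g0r p : g0 p \in ranges N p.
  rewrite /ranges /g0 -val_eqE; case: ltngtP => // _; first exact: segment0.
pose ps := enum {: entry m}.
pose f g := Acoc (config g y) + coboundary h (config g y).
have fC : `|avg (ranges N) ps f g0| <= C.
  by apply: avg_norm => // g /ranges_unitri; exact: hC.
have : avg (ranges N) ps f g0 = simplex_sign R m
    + \sum_(i < m.+2) (-1) ^+ i * avg (ranges N) ps (u i) g0.
  rewrite /f avgD; congr (_ + _); first exact: avg_eq.
  rewrite (@avg_sum _ _ _ _ _ (fun i g => (-1) ^+ i * u i g)) //.
  by apply: eq_bigr => i _; rewrite avgZ.
set s := \sum_(i < _) _ => fE.
have sk : `|s| <= k / N%:R.
  apply: le_trans (ler_norm_sum _ _ _) _.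
  apply: (@le_trans _ _ (\sum_(i < m.+2) #|{: entry m}|%:R * `|B| / N%:R)).
    apply: ler_sum => i _; rewrite normrM normrX normrN1 expr1n mul1r.
    exact: (avg_odd_small N0 (uB i) (uodd i) g0r).
  by rewrite sumr_const card_ord -[leLHS]mulr_natl /k mulrA.
rewrite -[leLHS](simplex_sign_norm R m).
rewrite (_ : simplex_sign R m = avg (ranges N) ps f g0 - s); last by rewrite fE addrK.
exact: le_trans (ler_normB _ _) (lerD fC sk).
Qed.

(** * Measurability and conclusion *)

(** A closed half-space is a countable union of boxes growing in all other directions. *)
Lemma measurable_coordinate (R : realType) (I : finType) (i : I) :
  measurable_fun [set: g_sigma_algebraType
      [set B : set (I -> R) | exists lo hi : I -> R, B = box lo hi]]
    (fun p : I -> R => p i).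
Proof.
apply: (measurability (@RGenCInfty.G R) (RGenCInfty.measurableE R)).
move=> _ [_ [x ->] <-]; rewrite setTI.
have -> : (fun p : I -> R => p i) @^-1` `[x, +oo[%classic
    = \bigcup_N box (fun j => if j == i then x else - N%:R) (fun _ => N%:R).
  apply/seteqP; split=> p.
    rewrite /= in_itv /= andbT => xp.
    pose N := Num.bound (\sum_j `|p j|); exists N => // j.
    have : `|p j| <= N%:R.
      apply: le_trans (ltW (archi_boundP _)); last exact: sumr_ge0.
      by rewrite (bigD1 j) //= lerDl sumr_ge0.
    rewrite ler_norml => /andP[h1 h2]; apply/andP; split=> //.
    by case: eqP => [->|].
  by move=> [N _ /(_ i)]; rewrite eqxx /= in_itv /= andbT => /andP[].
apply: bigcupT_measurable => N; apply: sub_sigma_algebra.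
by eexists; eexists.
Qed.

(** Invertibility of all entries is the nonvanishing of one polynomial, the product of the
    determinants. *)
Lemma tborel_GLt (R : realType) n k : tborel [set x : pts R n k | GLt x].
Proof.
pose T := g_sigma_algebraType [set B : set ('I_k * 'I_n * 'I_n -> R) |
  exists lo hi : 'I_k * 'I_n * 'I_n -> R, B = box lo hi].
pose D (i : 'I_k) (p : T) : R := \det (uncoords p i).
have mD i : measurable_fun [set: T] (D i).
  apply: measurable_sum => s; apply: measurable_funM; first exact: measurable_cst.
  apply: measurable_prod => j _.
  rewrite (_ : (fun p : T => uncoords p i j (s j)) = fun p : T => p (i, j, s j)).
    exact: measurable_coordinate.
  by apply/funext => p; rewrite mxE.
have mP : measurable_fun [set: T] (fun p : T => \prod_i D i p).
  by apply: measurable_prod => i _; exact: mD.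
have := mP measurableT _ (measurableC (measurable_set1 (0 : R))).
rewrite setTI /tborel; congr (borel _); apply/seteqP; split=> p /=.
  move/eqP/prodf_neq0 => h i; rewrite unitmxE unitfE; exact: h.
by move=> h; apply/eqP/prodf_neq0 => i _; rewrite -unitfE -unitmxE.
Qed.

Lemma Linf_eq_cst0 (R : realType) n k : Linf_eq (fun _ : pts R n.+1 k.+1 => 0).
Proof.
have null0 (S : set (pts R n.+1 k.+1)) : (forall x, ~ S x) -> tnull S.
  move=> S0; apply: lnull_sub (lnull_set0 (ord0, ord0, ord0)) => p /=; exact: S0.
split=> //.
- move=> a; case: (ltrP 0 a) => a0.
    rewrite (_ : [set x | _] = [set x | GLt x]); first exact: tborel_GLt.
    by apply/seteqP; split=> x // [].
  rewrite (_ : [set x | _] = set0); last by apply/seteqP; split=> x // [].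
  exact: sigma_algebra0.
- by exists 0; apply: null0 => x []; rewrite normr0 ltxx.
- by move=> g _; apply: null0 => x [_]; apply; rewrite mulr0.
Qed.

(** Shows that the infimum defining [esssup] is over an inhabited set, so that lower bounds pass to
    it. *)
Lemma ess_bounded_Acoc_coboundary (R : realType) n (h : pts R n.+1 n.+1 -> R) :
  ess_bounded h -> exists2 C : R, 0 <= C &
    tnull [set x | GLt x /\ C < `|Acoc x + coboundary h x|].
Proof.
move=> [B nB]; exists (1 + n.+2%:R * `|B|); first by rewrite addr_ge0 // mulr_ge0.
have nU : tnull (\bigcup_i [set x : pts R n.+1 n.+2 | GLt (face i x) /\ B < `|h (face i x)|]).
  apply: (tnull_bigcup (ord0 : 'I_n.+2)) => i.
  exact: (@tnull_face _ _ _ i [set w | GLt w /\ B < `|h w|]).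
apply: lnull_sub nU => p /= [pG lt]; apply: contrapT => np.
move: lt; rewrite ltNge => /negP; apply.
apply: le_trans (ler_normD _ _) _; apply: lerD; first exact: Acoc_le1.
rewrite coboundaryE; apply: le_trans (ler_norm_sum _ _ _) _.
apply: (@le_trans _ _ (\sum_(i < n.+2) `|B|)); last by rewrite sumr_const card_ord mulr_natl.
apply: ler_sum => i _; rewrite normrM normrX normrN1 expr1n mul1r.
apply: le_trans (ler_norm B); rewrite leNgt; apply/negP => lt.
by apply: np; exists i => //; split => // j; exact: pG.
Qed.

Theorem theorem6p1 (R : realType) (n : nat) : (0 < n)%N -> ~~ odd n -> normA R n = 1%R.
Proof.
case: n => // m _ /negbNE om.
have ge1 h : Linf_eq h -> 1 <= esssup (fun x : pts R m.+1 m.+2 => Acoc x + coboundary h x).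
  move=> [_ _ bh eh]; apply: lb_le_inf.
    by have [C C0 nC] := ess_bounded_Acoc_coboundary bh; exists C.
  by move=> C [_ nC]; exact: (Acoc_coboundary_bound om bh eh nC).
pose f0 := fun _ : pts R m.+1 m.+1 => 0 : R.
have f0L : Linf_eq f0 by exact: Linf_eq_cst0.
apply/eqP; rewrite eq_le; apply/andP; split; last first.
  apply: lb_le_inf; first by exists (esssup (fun x => Acoc x + coboundary f0 x)); exists f0.
  by move=> _ [h hL <-]; exact: ge1.
apply: (@le_trans _ _ (esssup (fun x => Acoc x + coboundary f0 x))).
  apply: ge_inf; last by exists f0.
  by exists 1 => _ [h hL <-]; exact: ge1.
apply: ge_inf; first by exists 0 => C [].
(* For [h = 0] the set where the bound 1 is exceeded is empty. *)
split=> //; apply: lnull_sub (lnull_set0 (ord0, ord0, ord0)) => p /= [_].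
rewrite coboundaryE big1 => [|i _]; last by rewrite mulr0.
by rewrite addr0 ltNge Acoc_le1.
Qed.
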